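(* Let $\mathcal{A}$ be a unital simple C$^*$-algebra admitting a faithful tracial state $\tau$. Let $\phi:\mathcal{A}\to\mathcal{A}$ be a map (not assumed linear, additive or continuous) such that for any $a,b\in\mathcal{A}$ there is a linear derivation $D_{a,b}:\mathcal{A}\to\mathcal{A}$ with $$\phi(a)b+a\phi(b)=D_{a,b}(ab).$$ Then $\phi$ is a linear derivation.
   Context: A linear derivation of $\mathcal{A}$ is a linear map $D:\mathcal{A}\to\mathcal{A}$ with $D(ab)=D(a)b+aD(b)$ for all $a,b\in\mathcal{A}$. A faithful tracial state is a positive linear functional $\tau$ with $\tau(1)=1$, $\tau(ab)=\tau(ba)$ for all $a,b$, and $\tau(x^*x)=0$ only if $x=0$. *)

(* Defs.v *)
From HB Require Import structures.
From mathcomp Require Import all_boot all_order all_algebra.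
From mathcomp Require Import all_classical all_reals all_analysis.
From mathcomp Require Import complex.
Set Implicit Arguments. Unset Strict Implicit. Unset Printing Implicit Defensive.
Import Order.TTheory GRing.Theory Num.Theory.
Import numFieldNormedType.Exports.
Local Open Scope ring_scope.
Local Open Scope classical_set_scope.

(* Scalar field: the complex numbers C = R[i] over a real type R. *)
Section Cstar.
Variable R : realType.
Local Notation C := R[i].
Variable A : completeNormedModType C.
(* multiplication, unit and involution on the Banach space A *)
Variables (mul : A -> A -> A) (one : A) (star : A -> A).

Definition unital_Cstar_algebra : Prop :=
  [/\ (forall a b c, mul a (mul b c) = mul (mul a b) c),
      (forall a, mul one a = a /\ mul a one = a),
      (forall a b c, mul (a + b) c = mul a c + mul b c /\ mul a (b + c) = mul a b + mul a c),
      (forall (z : C) a b, mul (z *: a) b = z *: mul a b /\ mul a (z *: b) = z *: mul a b) &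
      (forall a b, `|mul a b| <= `|a| * `|b|) /\ one != 0] /\
      [/\ (forall a b, star (a + b) = star a + star b),
          (forall (z : C) a, star (z *: a) = (z^*)%C *: star a),
          (forall a b, star (mul a b) = mul (star b) (star a)),
          (forall a, star (star a) = a) &
          (forall a, `|mul (star a) a| = `|a| ^+ 2)].

(* closed two-sided ideal *)
Definition closed_two_sided_ideal (I : set A) : Prop :=
  [/\ I 0, (forall x y, I x -> I y -> I (x + y)),
      (forall (z : C) x, I x -> I (z *: x)),
      (forall a x, I x -> I (mul a x) /\ I (mul x a)) & closed I].

(* simple: no nontrivial closed two-sided ideals *)
Definition simple_algebra : Prop :=
  forall I : set A, closed_two_sided_ideal I -> I = [set 0] \/ I = setT.

Definition is_linear (f : A -> A) : Prop :=
  (forall a b, f (a + b) = f a + f b) /\ (forall (z : C) a, f (z *: a) = z *: f a).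

Definition linear_derivation (D : A -> A) : Prop :=
  is_linear D /\ forall a b, D (mul a b) = mul (D a) b + mul a (D b).

Definition faithful_tracial_state (tau : A -> C) : Prop :=
  [/\ (forall a b, tau (a + b) = tau a + tau b),
      (forall (z : C) a, tau (z *: a) = z * tau a),
      (forall a, 0 <= tau (mul (star a) a)) /\ tau one = 1,
      (forall a b, tau (mul a b) = tau (mul b a)) &
      (forall x, tau (mul (star x) x) = 0 -> x = 0)].
End Cstar.

(* Main.v *)
Require Import Defs.
From HB Require Import structures.
From mathcomp Require Import all_boot all_order all_algebra.
From mathcomp Require Import all_classical all_reals all_analysis.
From mathcomp Require Import complex ring lra.
From Stdlib Require Ncring_tac.
Set Implicit Arguments.
Unset Strict Implicit.
Unset Printing Implicit Defensive.
Import Order.TTheory GRing.Theory Num.Theory.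
Import numFieldNormedType.Exports.
Local Open Scope ring_scope.

(* The trace kills every derivation D, and this forces linearity: applying tau to
   the hypothesis gives tau (phi a b) = - tau (a phi b), and tau is faithful. Next,
   a b = 1 gives phi a b + a phi b = D 1 = 0, so that Hua's trick with
   (1 - x)^-1 + (1 + x)^-1 = 2 (1 - x^2)^-1 makes phi a Jordan derivation, and
   Herstein's argument, in the semiprime algebra A, makes it a derivation.

   That tau D = 0 is proved without Sakai's theorem on inner derivations. Split D
   into *-derivations. The separating space of a *-derivation is a closed ideal; it
   does not contain 1, for otherwise D x would be close to 1 for some self-adjoint x,
   which fails "where |x| attains its norm", as seen by differentiating
   g^2 = 1 - x^2. So simplicity and the closed graph theorem make D bounded. Then
   u |-> tau (u^* D u) is a bounded homomorphism from the unitary group to C, hence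
   zero; the unitaries (1 - t^2 x^2)^(1/2) + i t x with t -> 0 give tau (D x) = 0. *)

(** * Jordan derivations of semiprime rings *)

(** Bridge to the non-commutative ring tactic of the standard library: with these instances
    [nc_ring] closes polynomial identities in any [pzRingType]. *)
#[global] Instance ncring_ops (B : pzRingType) :
  @Ncring.Ring_ops B 0 1 +%R *%R (fun x y => x - y) -%R (@eq B) := {}.

#[global] Instance ncring_ring (B : pzRingType) :
  @Ncring.Ring B 0 1 +%R *%R (fun x y => x - y) -%R (@eq B) (ncring_ops B).
Proof.
split; cbv [Ncring.eq_notation Ncring.add_notation Ncring.mul_notation
  Ncring.sub_notation Ncring.opp_notation Ncring.zero_notation
  Ncring.one_notation Algebra_syntax.equality Algebra_syntax.addition
  Algebra_syntax.multiplication Algebra_syntax.subtraction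
  Algebra_syntax.opposite Algebra_syntax.zero Algebra_syntax.one].
- exact: RelationClasses.eq_equivalence.
- by move=> x y -> z t ->.
- by move=> x y -> z t ->.
- by move=> x y -> z t ->.
- by move=> x y ->.
- exact: add0r.
- exact: addrC.
- exact: addrA.
- exact: mul1r.
- exact: mulr1.
- exact: mulrA.
- exact: mulrDl.
- by move=> x y z; exact: mulrDr.
- by [].
- exact: subrr.
Qed.

Ltac nc_ring :=
  match goal with |- @eq ?T ?a ?b => change (@Algebra_syntax.equality T _ a b) end;
  Ncring_tac.non_commutative_ring.

Section JordanDerivation.
Variables (B : pzRingType) (phi : B -> B).
Hypothesis torsion2 : forall x : B, x + x = 0 -> x = 0.
Hypothesis phiD : forall x y, phi (x + y) = phi x + phi y.
Hypothesis phi_sqr : forall x, phi (x * x) = phi x * x + x * phi x.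

Let double_inj (x y : B) : x + x = y + y -> x = y.
Proof.
by move=> h; apply/subr0_eq/torsion2; rewrite addrACA h -opprD subrr.
Qed.

(** Polarization of [phi_sqr]: expand at [x + y] and cancel the two squares. *)
Lemma jordan_prod x y :
  phi (x * y) + phi (y * x) = phi x * y + x * phi y + phi y * x + y * phi x.
Proof.
have := phi_sqr (x + y).
have -> : (x + y) * (x + y) = x * x + (x * y + (y * x + y * y)) by nc_ring.
rewrite !phiD !phi_sqr
  => /(congr1 (fun z => z - (phi x * x + x * phi x) - (phi y * y + y * phi y))).
have -> (p q r s : B) : p + (q + (r + s)) - p - s = q + r by nc_ring.
by move=> ->; nc_ring.
Qed.

(** With [s = x y + y x] one has [x s + s x = x^2 y + y x^2 + 2 x y x]. Applying [jordan_prod] to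
    [x, s] and to [x^2, y] gives twice the claim. *)
Lemma jordan_triple x y :
  phi (x * y * x) = phi x * y * x + x * phi y * x + x * y * phi x.
Proof.
apply: double_inj.
have := jordan_prod x (x * y + y * x).
have -> : x * (x * y + y * x) = x * x * y + x * y * x by nc_ring.
have -> : (x * y + y * x) * x = x * y * x + y * (x * x) by nc_ring.
have := jordan_prod (x * x) y.
rewrite !phiD !phi_sqr (jordan_prod x y) => h1 h2.
have -> : phi (x * y * x) + phi (x * y * x) =
  (phi (x * x * y) + phi (x * y * x) + (phi (x * y * x) + phi (y * (x * x)))) -
  (phi (x * x * y) + phi (y * (x * x))) by nc_ring.
by rewrite h2 h1; nc_ring.
Qed.

(** Polarization of [jordan_triple] in its outer variable. *)
Lemma jordan_triple_lin x y z :
  phi (x * y * z) + phi (z * y * x) =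
  phi x * y * z + x * phi y * z + x * y * phi z +
  (phi z * y * x + z * phi y * x + z * y * phi x).
Proof.
have := jordan_triple (x + z) y.
have -> : (x + z) * y * (x + z) =
  x * y * x + (x * y * z + (z * y * x + z * y * z)) by nc_ring.
rewrite !phiD !jordan_triple => h.
have -> : phi (x * y * z) + phi (z * y * x) =
  (phi x * y * x + x * phi y * x + x * y * phi x +
   (phi (x * y * z) + (phi (z * y * x) +
     (phi z * y * z + z * phi y * z + z * y * phi z)))) -
  (phi x * y * x + x * phi y * x + x * y * phi x) -
  (phi z * y * z + z * phi y * z + z * y * phi z) by nc_ring.
by rewrite h; nc_ring.
Qed.

Definition leibniz_defect x y := phi (x * y) - phi x * y - x * phi y.
Local Notation Delta := leibniz_defect.

Lemma leibniz_defectC x y : Delta y x = - Delta x y.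
Proof.
apply/eqP; rewrite -addr_eq0; apply/eqP.
have -> : Delta y x + Delta x y = phi (x * y) + phi (y * x) -
   (phi x * y + x * phi y + phi y * x + y * phi x) by rewrite /Delta; nc_ring.
by rewrite jordan_prod subrr.
Qed.

Lemma leibniz_defectDl x x' y : Delta (x + x') y = Delta x y + Delta x' y.
Proof. by rewrite /Delta mulrDl !phiD; nc_ring. Qed.

Lemma leibniz_defectDr x y y' : Delta x (y + y') = Delta x y + Delta x y'.
Proof. by rewrite /Delta mulrDr !phiD; nc_ring. Qed.

(* Evaluate phi at [abxba + baxab], seen as [a(bxb)a + b(axa)b] and as [(ab)x(ba) + (ba)x(ab)]. *)
Lemma leibniz_defect_comm a b x :
  Delta a b * x * (a * b - b * a) + (a * b - b * a) * x * Delta a b = 0.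
Proof.
have e1 := jordan_triple a (b * x * b); have e2 := jordan_triple b (a * x * a).
have := jordan_triple_lin (a * b) x (b * a).
have -> : a * b * x * (b * a) = a * (b * x * b) * a by nc_ring.
have -> : b * a * x * (a * b) = b * (a * x * a) * b by nc_ring.
rewrite e1 e2 !jordan_triple => h.
have -> : Delta a b * x * (a * b - b * a) + (a * b - b * a) * x * Delta a b =
  - (Delta a b * x * (b * a) + Delta b a * x * (a * b) +
     a * b * x * Delta b a + b * a * x * Delta a b).
  by rewrite (leibniz_defectC a b); nc_ring.
rewrite /Delta; apply/eqP; rewrite oppr_eq0; apply/eqP.
set L := (X in X = _) in h; set M := (X in _ = X) in h.
have <- : M - L = 0 by rewrite h subrr.
by rewrite /L /M; nc_ring.
Qed.

Hypothesis semiprime : forall x : B, (forall y, x * y * x = 0) -> x = 0.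

(** Let [W = p x q y p x q]. The hypothesis applied to the inner [q y p] gives
    [W = - p (x p y) q x q]; applied to [p (x p y) q] and then to [q x p], it gives
    [p (x p y) q x q = W]. So [2 W = 0] for every [y], and semiprimeness concludes. *)
Lemma semiprime_comm (p q : B) :
  (forall x, p * x * q + q * x * p = 0) -> forall x, p * x * q = 0.
Proof.
move=> h x; apply: semiprime => y; apply: torsion2.
have e z : p * z * q = - (q * z * p) by apply/eqP; rewrite -addr_eq0 h.
have e1 : p * x * q * y * (p * x * q) = - (p * (x * p * y) * q * x * q).
  transitivity (p * x * (q * y * p) * x * q); first by nc_ring.
  by rewrite -[q * y * p]opprK -e; nc_ring.
have e2 : p * (x * p * y) * q * x * q = p * x * q * y * (p * x * q).
  rewrite (e (x * p * y)).
  have -> : - (q * (x * p * y) * p) * x * q = - (q * x * p) * y * (p * x * q) by nc_ring.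
  by rewrite -e.
by rewrite {1}e1 e2 addNr.
Qed.

(** The case [c = a], [d = b] comes from [leibniz_defect_comm]; the pairs are then separated by
    linearizing first in [a], then in [b]. Each time the two cross terms are opposite, so in
    [T z T], with [T] the product to be killed, replacing the second [T] by its opposite partner
    exposes a product already known to vanish. *)
Lemma leibniz_defect_mul_comm a b c d x :
  Delta a b * x * (c * d - d * c) = 0.
Proof.
have step1 a' b' y : Delta a' b' * y * (a' * b' - b' * a') = 0.
  by apply: semiprime_comm => z; exact: leibniz_defect_comm.
have step2 a' b' c' y : Delta a' b' * y * (c' * b' - b' * c') = 0.
  apply: semiprime => z.
  have lin t : Delta a' b' * t * (c' * b' - b' * c') =
      - (Delta c' b' * t * (a' * b' - b' * a')).
    apply/eqP; rewrite -addr_eq0 -(step1 (a' + c') b' t).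
    rewrite leibniz_defectDl; apply/eqP.
    transitivity (Delta a' b' * t * (a' * b' - b' * a') +
      Delta a' b' * t * (c' * b' - b' * c') +
      Delta c' b' * t * (a' * b' - b' * a') +
      Delta c' b' * t * (c' * b' - b' * c')); last by nc_ring.
    by rewrite !step1 add0r addr0.
  rewrite {2}lin.
  transitivity (- (Delta a' b' * (y * (c' * b' - b' * c') * z * Delta c' b' * y) *
     (a' * b' - b' * a'))); first by nc_ring.
  by rewrite step1 oppr0.
apply: semiprime => z.
have lin t : Delta a b * t * (c * d - d * c) =
    - (Delta a d * t * (c * b - b * c)).
  apply/eqP; rewrite -addr_eq0 -(step2 a (b + d) c t).
  rewrite leibniz_defectDr; apply/eqP.
  transitivity (Delta a b * t * (c * b - b * c) +
    Delta a b * t * (c * d - d * c) +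
    Delta a d * t * (c * b - b * c) +
    Delta a d * t * (c * d - d * c)); last by nc_ring.
  by rewrite !step2 add0r addr0.
rewrite {2}lin.
transitivity (- (Delta a b * (x * (c * d - d * c) * z * Delta a d * x) *
   (c * b - b * c))); first by nc_ring.
by rewrite step2 oppr0.
Qed.

End JordanDerivation.

(** * Norm and involution *)

(* The norm takes values in [R], so that real-field tactics apply to estimates. *)
Record cstar_norm (R : realType) (B : algType R[i]) (N : B -> R)
    (star : B -> B) : Prop := CstarNorm {
  cstar_normD : forall a b, N (a + b) <= N a + N b;
  cstar_norm_eq0 : forall a, N a = 0 -> a = 0;
  cstar_normZ : forall z a, ((N (z *: a))%:C = `|z| * (N a)%:C)%C;
  cstar_normM : forall a b, N (a * b) <= N a * N b;
  cstar_complete : forall u : nat -> B,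
    (forall e : R, 0 < e -> exists n0, forall m n, (n0 <= m)%N -> (n0 <= n)%N ->
       N (u m - u n) < e) ->
    exists l, forall e : R, 0 < e -> exists n0, forall n, (n0 <= n)%N ->
       N (u n - l) < e;
  cstar_starD : forall a b, star (a + b) = star a + star b;
  cstar_starZ : forall z a, star (z *: a) = (z^*)%C *: star a;
  cstar_starM : forall a b, star (a * b) = star b * star a;
  cstar_starK : forall a, star (star a) = a;
  cstar_normsq : forall a, N (star a * a) = N a ^+ 2 }.

Section CstarNorm.
Variables (R : realType) (B : algType R[i]) (N : B -> R) (star : B -> B).
Hypothesis cs : cstar_norm N star.
Implicit Types (x y : B) (r : R).

Let ND := cstar_normD cs.
Let NM := cstar_normM cs.
Let starD := cstar_starD cs.
Let starZ := cstar_starZ cs.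
Let starM := cstar_starM cs.
Let starK := cstar_starK cs.

Lemma cstar_normZr r x : N (r%:C%C *: x) = `|r| * N x.
Proof.
apply: (@complexI R); rewrite (cstar_normZ cs) normc_def /= expr0n addr0 sqrtr_sqr.
by rewrite rmorphM.
Qed.

Lemma cstar_normZi x : N ('i%C *: x) = N x.
Proof.
apply: (@complexI R); rewrite (cstar_normZ cs) normc_def /= expr0n add0r expr1n sqrtr1.
by rewrite mul1r.
Qed.

Lemma cstar_normN x : N (- x) = N x.
Proof.
by rewrite -scaleN1r -(rmorphN1 (real_complex R)) cstar_normZr normrN1 mul1r.
Qed.

Lemma cstar_norm0 : N 0 = 0.
Proof. by rewrite -(scale0r (0 : B)) -(rmorph0 (real_complex R)) cstar_normZr normr0 mul0r. Qed.

Lemma cstar_norm_ge0 x : 0 <= N x.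
Proof.
by have := ND x (- x); rewrite subrr cstar_norm0 cstar_normN; lra.
Qed.

Let N0 := cstar_norm_ge0.

Lemma cstar_normB x y : N (x - y) <= N x + N y.
Proof. by rewrite -(cstar_normN y); exact: ND. Qed.

Lemma cstar_distC x y : N (x - y) = N (y - x).
Proof. by rewrite -opprB cstar_normN. Qed.

Lemma cstar_dist_triangle z x y : N (x - y) <= N (x - z) + N (z - y).
Proof. by rewrite -[x - y](subrKA z); exact: ND. Qed.

Lemma cstar_star0 : star 0 = 0.
Proof. by rewrite -(scale0r (0 : B)) starZ conjc0 !scale0r. Qed.

Lemma cstar_starN x : star (- x) = - star x.
Proof.
by apply/eqP; rewrite -addr_eq0 -starD addNr cstar_star0.
Qed.

Lemma cstar_starB x y : star (x - y) = star x - star y.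
Proof. by rewrite starD cstar_starN. Qed.

Lemma cstar_star1 : star 1 = 1.
Proof. by rewrite -[star 1]mul1r -{1}(starK 1) -starM mul1r starK. Qed.

Lemma cstar_starZr r x : star (r%:C%C *: x) = r%:C%C *: star x.
Proof. by rewrite starZ /= oppr0. Qed.

Lemma cstar_starZi x : star ('i%C *: x) = - ('i%C *: star x).
Proof. by rewrite starZ -scaleNr; congr (_ *: _); apply/eqP; rewrite eq_complex /= oppr0 !eqxx. Qed.

Lemma cstar_norm_star x : N (star x) = N x.
Proof.
have le y : N y <= N (star y).
  have := NM (star y) y; rewrite (cstar_normsq cs).
  have [->|/eqP y0] := eqVneq (N y) 0; first by rewrite N0.
  have : 0 < N y by rewrite lt_neqAle eq_sym N0 andbT; apply/eqP.
  by rewrite expr2 => h; rewrite ler_pM2r.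
by apply/eqP; rewrite eq_le le andbT -{2}(starK x) le.
Qed.

Lemma cstar_norm1 : N 1 = 1.
Proof.
have := cstar_normsq cs 1; rewrite mulr1 cstar_star1 expr2.
have h : N 1 != 0.
  by apply/eqP => /(cstar_norm_eq0 cs) /eqP; rewrite oner_eq0.
by move=> /(congr1 (fun t => t / N 1)); rewrite mulfK // divff.
Qed.

Lemma cstar_norm_sqr x : star x = x -> N (x * x) = N x ^+ 2.
Proof. by move=> sx; rewrite -{1}sx (cstar_normsq cs). Qed.

Lemma cstar_half x : ((2^-1 : R)%:C%C *: x) + ((2^-1 : R)%:C%C *: x) = x.
Proof.
rewrite -scalerDl -rmorphD.
have -> : (2^-1 + 2^-1 : R) = 1 by lra.
by rewrite rmorph1 scale1r.
Qed.

Lemma cstar_torsion2 x : x + x = 0 -> x = 0.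
Proof.
by move=> h; rewrite -(cstar_half x) -scalerDr h scaler0.
Qed.

Lemma cstar_norm_le0 x : (forall e : R, 0 < e -> N x <= e) -> x = 0.
Proof.
move=> h; apply: (cstar_norm_eq0 cs); apply/eqP; rewrite eq_le N0 andbT.
by apply/ler_addgt0Pr => e e0; rewrite add0r h.
Qed.

(** For the self-adjoint [p = star x * x] the hypothesis gives [p^2 = 0], hence
    [N x ^+ 4 = N p ^+ 2 = N (p * p) = 0]. *)
Lemma cstar_semiprime x : (forall y, x * y * x = 0) -> x = 0.
Proof.
move=> h; pose p := star x * x.
have sp : star p = p by rewrite /p starM starK.
have pp : p * p = 0 by rewrite /p -mulrA [x * _]mulrA h mulr0.
have := cstar_norm_sqr sp; rewrite pp cstar_norm0 (cstar_normsq cs) => /esym/eqP.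
by rewrite !expf_eq0 /= => /eqP /(cstar_norm_eq0 cs).
Qed.

(** Method of majorants: increments dominated by those of a bounded real sequence give a limit
    together with an explicit error bound. Square roots, nested balls and geometric series all use
    it. *)
Lemma cstar_cvg_majorant (u : nat -> B) (v : nat -> R) (V : R) :
  (forall n, N (u n.+1 - u n) <= v n.+1 - v n) -> (forall n, v n <= V) ->
  exists l, (forall e : R, 0 < e -> exists n0, forall n, (n0 <= n)%N -> N (u n - l) < e)
    /\ forall n, N (u n - l) <= V - v n.
Proof.
move=> uv vV.
have inc n k : N (u (n + k)%N - u n) <= v (n + k)%N - v n.
  elim: k => [|k ih]; first by rewrite addn0 !subrr cstar_norm0.
  have := cstar_dist_triangle (u (n + k)%N) (u (n + k.+1)%N) (u n).
  by have := uv (n + k)%N; rewrite addnS; lra.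
have mono n m : (n <= m)%N -> v n <= v m.
  by move=> /subnKC <-; have := inc n (m - n)%N; have := N0 (u (n + (m - n))%N - u n); lra.
pose S := [set v n | n in [set: nat]]%classic.
have hS : has_sup S.
  split; first by exists (v 0%N); exists 0%N.
  by exists V => _ [n _ <-].
have cauchy (e : R) : 0 < e -> exists n0, forall m n, (n0 <= m)%N -> (n0 <= n)%N ->
    N (u m - u n) < e.
  move=> e0; have [_ [n0 _ <-] hn0] := sup_adherent e0 hS.
  have bd n : v n <= sup S by apply: ub_le_sup; [exact: hS.2 | exists n].
  have key m n : (n0 <= n)%N -> (n <= m)%N -> N (u m - u n) < e.
    move=> n0n /subnKC <-; have := inc n (m - n)%N.
    by have := mono _ _ n0n; have := bd (n + (m - n))%N; lra.
  exists n0 => m n n0m n0n.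
  by have [nm|/ltnW mn] := leqP n m; [exact: key | rewrite cstar_distC; exact: key].
have [l hl] := cstar_complete cs cauchy.
exists l; split => // n; apply/ler_addgt0Pr => e /hl [n0 hn0].
have := hn0 (n + n0)%N (leq_addl _ _).
have := inc n n0; have := vV (n + n0)%N.
have := cstar_dist_triangle (u (n + n0)%N) (u n) l.
by rewrite (cstar_distC (u n) (u _)); lra.
Qed.

Lemma cstar_cvg_geom (u : nat -> B) (K q : R) : 0 <= q -> q < 1 -> 0 <= K ->
  (forall n, N (u n.+1 - u n) <= K * q ^+ n) ->
  exists l, (forall e : R, 0 < e -> exists n0, forall n, (n0 <= n)%N -> N (u n - l) < e)
    /\ forall n, N (u n - l) <= K / (1 - q) * q ^+ n.
Proof.
move=> q0 q1 K0 hu.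
(* The majorant is minus the tail of the geometric series; its increments are exactly [K * q ^+ n]
   and it is bounded by [0]. *)
have [||l [h1 h2]] := @cstar_cvg_majorant u (fun n => - (K / (1 - q) * q ^+ n)) 0.
- move=> n; apply: le_trans (hu n) _; rewrite exprS le_eqVlt; apply/orP; left; apply/eqP.
  by field; rewrite subr_eq0 eq_sym lt_eqF.
- by move=> n; rewrite oppr_le0 mulr_ge0 ?exprn_ge0 // divr_ge0 // subr_ge0 ltW.
by exists l; split => // n; have := h2 n; rewrite sub0r opprK.
Qed.

End CstarNorm.

(** * Inverses and square roots *)

Lemma geom_small (R : realType) (K q e : R) : 0 <= q -> q < 1 -> 0 < e ->
  exists n, K * q ^+ n < e.
Proof.
move=> q0 q1 e0.
have : ((fun n => K * q ^+ n) @ \oo --> (0 : R))%classic.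
  by apply: cvg_geometric; rewrite ger0_norm.
move=> /cvgrPdist_lt /(_ e e0) [n _ hn]; exists n.
by have := hn n (leqnn n); rewrite sub0r normrN => /(le_lt_trans (ler_norm _)).
Qed.

Section CstarCalculus.
Variables (R : realType) (B : algType R[i]) (N : B -> R) (star : B -> B).
Hypothesis cs : cstar_norm N star.
Implicit Types (x y : B) (r : R).

Let ND := cstar_normD cs.
Let NM := cstar_normM cs.
Let N0 := cstar_norm_ge0 cs.
Let starD := cstar_starD cs.
Let starM := cstar_starM cs.

Lemma cstar_normX x n : N (x ^+ n) <= N x ^+ n.
Proof.
elim: n => [|n ih]; first by rewrite !expr0 (cstar_norm1 cs).
by rewrite !exprS; apply: le_trans (NM _ _) _; rewrite ler_wpM2l.
Qed.

(** Used to pass identities to the limit: the defect [x] of an identity for [l] vanishes once it is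
    controlled by the errors of two consecutive iterates. *)
Lemma cstar_eq0_cvg (u : nat -> B) l x (K : R) :
  (forall e : R, 0 < e -> exists n0, forall n, (n0 <= n)%N -> N (u n - l) < e) ->
  (forall n, N x <= K * (N (u n - l) + N (u n.+1 - l))) -> x = 0.
Proof.
move=> hl hx; apply: (cstar_norm_le0 cs) => e e0.
have K0 : 0 < `|K| + 1 by have := normr_ge0 K; lra.
have [|n0 hn] := hl (e / (2 * (`|K| + 1))); first by rewrite divr_gt0 // mulr_gt0.
have h1 := hn n0 (leqnn _); have h2 := hn n0.+1 (leqnSn _).
apply: le_trans (hx n0) _.
have -> : e = (`|K| + 1) * (e / (2 * (`|K| + 1)) + e / (2 * (`|K| + 1))).
  by field; rewrite gt_eqF.
have [p1 p2] := (N0 (u n0 - l), N0 (u n0.+1 - l)).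
apply: (@le_trans _ _ ((`|K| + 1) * (N (u n0 - l) + N (u n0.+1 - l)))).
  by rewrite ler_wpM2r ?addr_ge0 //; have := ler_norm K; lra.
by rewrite ler_pM2l // lerD // ltW.
Qed.

Lemma comm_inverse x y w : w * x = 1 -> x * w = 1 -> y * x = x * y -> y * w = w * y.
Proof.
move=> wx xw yx; transitivity (w * x * (y * w)); first by rewrite wx mul1r.
by rewrite -mulrA [x * _]mulrA -yx -[y * x * w]mulrA xw mulr1.
Qed.

Lemma cstar_neumann q : N q < 1 -> exists w, w * (1 - q) = 1 /\ (1 - q) * w = 1.
Proof.
move=> q1; pose u n := \sum_(i < n) q ^+ i.
have uS n : u n.+1 = u n + q ^+ n by rewrite /u big_ord_recr.
have uL n : (1 - q) * u n = 1 - q ^+ n.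
  elim: n => [|n ih]; first by rewrite /u big_ord0 mulr0 expr0 subrr.
  by rewrite uS mulrDr ih exprS; nc_ring.
have uR n : u n * (1 - q) = 1 - q ^+ n.
  elim: n => [|n ih]; first by rewrite /u big_ord0 mul0r expr0 subrr.
  by rewrite uS mulrDl ih exprSr; nc_ring.
have [||l [hl _]] := @cstar_cvg_geom _ _ _ _ cs u 1 (N q) (N0 q) q1.
- by [].
- by move=> n; rewrite uS addrC addKr mul1r cstar_normX.
exists l.
(* The remainder [q ^+ n] is itself a difference of two consecutive errors, which gives the bound
   required by [cstar_eq0_cvg]. *)
have qn n : q ^+ n = u n.+1 - l - (u n - l) by rewrite uS; nc_ring.
split; apply/subr0_eq; apply: (@cstar_eq0_cvg u l _ (N (1 - q) + 1) hl) => n.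
- have -> : l * (1 - q) - 1 = - ((u n - l) * (1 - q)) - q ^+ n.
    by rewrite mulrBl uR; nc_ring.
  rewrite qn; apply: le_trans (cstar_normB cs _ _) _; rewrite (cstar_normN cs).
  have := cstar_normB cs (u n.+1 - l) (u n - l); have := NM (u n - l) (1 - q).
  have := N0 (u n - l); have := N0 (u n.+1 - l); have := N0 (1 - q).
  by nra.
have -> : (1 - q) * l - 1 = - ((1 - q) * (u n - l)) - q ^+ n.
  by rewrite mulrBr uL; nc_ring.
rewrite qn; apply: le_trans (cstar_normB cs _ _) _; rewrite (cstar_normN cs).
have := cstar_normB cs (u n.+1 - l) (u n - l); have := NM (1 - q) (u n - l).
have := N0 (u n - l); have := N0 (u n.+1 - l); have := N0 (1 - q).
by nra.
Qed.

(* Iterating [z |-> (y + z^2) / 2] from [0] converges to [k] with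
   [k = (y + k^2) / 2]; the same iteration for the real number [1] is a majorant. *)
Lemma cstar_sqrt y : star y = y -> N y <= 1 ->
  exists k, [/\ star k = k, N k <= N y, (1 - k) * (1 - k) = 1 - y &
    forall a, a * y = y * a -> a * k = k * a].
Proof.
move=> sy y1; pose h : R[i] := ((2^-1 : R)%:C)%C.
pose f z := h *: (y + z * z); pose u n := iter n f 0.
pose g (t : R) := (1 + t * t) / 2; pose v n := iter n g 0.
have uS n : u n.+1 = f (u n) by []. have vS n : v n.+1 = g (v n) by [].
have hh x : h *: x + h *: x = x := cstar_half x.
have Nh x : N (h *: x) = N x / 2.
  by rewrite (cstar_normZr cs) ger0_norm ?invr_ge0 // mulrC.
have ucomm a n : a * y = y * a -> a * u n = u n * a.
  move=> ay; elim: n => [|n ih]; first by rewrite mulr0 mul0r.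
  rewrite uS -scalerAl -scalerAr mulrDr mulrDl ay; congr (_ *: (_ + _)).
  by rewrite mulrA ih -!mulrA ih.
have ustar n : star (u n) = u n.
  elim: n => [|n ih]; first exact: cstar_star0 cs.
  by rewrite uS (cstar_starZr cs) starD starM sy ih.
have uN n : N (u n) <= N y.
  elim: n => [|n ih]; first by rewrite (cstar_norm0 cs).
  rewrite uS Nh; have := ND y (u n * u n); have := NM (u n) (u n).
  have : N (u n) * N (u n) <= N y by have := N0 (u n); nra.
  by lra.
have v01 n : 0 <= v n <= 1.
  elim: n => [|n /andP[a b]]; first by rewrite lexx ler01.
  by rewrite vS /g; apply/andP; split; nra.
have uv n : N (u n) <= v n.
  elim: n => [|n ih]; first by rewrite (cstar_norm0 cs).
  rewrite uS Nh vS /g; have := ND y (u n * u n); have := NM (u n) (u n).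
  have : N (u n) * N (u n) <= v n * v n by apply: ler_pM.
  by lra.
have uvar n : N (u n.+1 - u n) <= v n.+1 - v n.
  elim: n => [|n ih].
    have -> : v 1%N - v 0%N = 1 / 2 by rewrite /v /= /g; lra.
    by rewrite uS /= /f mulr0 addr0 subr0 Nh; lra.
  (* A difference of squares factors here because the iterates commute with [y], hence with one
     another. *)
  have -> : u n.+2 - u n.+1 = h *: ((u n.+1 - u n) * (u n.+1 + u n)).
    rewrite (uS n.+1) {2}(uS n) /f -scalerBr; congr (_ *: _).
    have e : u n.+1 * u n = u n * u n.+1 by apply: (ucomm); exact: esym (ucomm y n.+1 erefl).
    transitivity (u n.+1 * u n.+1 - u n * u n + (u n.+1 * u n - u n * u n.+1)).
      by rewrite e; nc_ring.
    by nc_ring.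
  rewrite Nh (vS n.+1) {2}(vS n) /g.
  have p1 : N (u n.+1 + u n) <= v n.+1 + v n.
    by have := ND (u n.+1) (u n); have := uv n; have := uv n.+1; lra.
  have : N (u n.+1 - u n) * N (u n.+1 + u n) <= (v n.+1 - v n) * (v n.+1 + v n) by apply: ler_pM.
  by have := NM (u n.+1 - u n) (u n.+1 + u n); lra.
have [|k [hk _]] := @cstar_cvg_majorant _ _ _ _ cs u v 1 uvar.
  by move=> n; have /andP[] := v01 n.
exists k.
have fk : f k = k.
  apply/subr0_eq; apply: (@cstar_eq0_cvg u k _ (1 + N k) hk) => n.
  have -> : f k - k = (u n.+1 - k) - h *: (u n * (u n - k) + (u n - k) * k).
    rewrite uS /f; rewrite !scalerDr !mulrBr !mulrBl !scalerBr.
    by move: (h *: y) (h *: (u n * u n)) (h *: (u n * k)) (h *: (k * k)) => p q r s; nc_ring.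
  have := cstar_normB cs (u n.+1 - k) (h *: (u n * (u n - k) + (u n - k) * k)).
  rewrite Nh; have := ND (u n * (u n - k)) ((u n - k) * k).
  have := NM (u n) (u n - k); have := NM (u n - k) k.
  have := N0 (u n - k); have := N0 (u n.+1 - k); have := N0 k; have := N0 (u n).
  by have := uN n; nra.
split.
- apply/subr0_eq; apply: (@cstar_eq0_cvg u k _ 2 hk) => n.
  have -> : star k - k = (u n - k) - star (u n - k).
    by rewrite (cstar_starB cs) ustar; nc_ring.
  apply: le_trans (cstar_normB cs _ _) _; rewrite (cstar_norm_star cs).
  by have := N0 (u n.+1 - k); lra.
- apply/ler_addgt0Pr => e /hk [n0 /(_ n0 (leqnn _))].
  have := ND (u n0) (k - u n0); rewrite addrC subrK (cstar_distC cs k).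
  by have := uN n0; lra.
- have := hh (y + k * k); rewrite -/(f k) fk => e.
  have -> : y = k + k - k * k by rewrite e; nc_ring.
  by nc_ring.
move=> a ay; apply/subr0_eq; apply: (@cstar_eq0_cvg u k _ (N a + N a) hk) => n.
have -> : a * k - k * a = (u n - k) * a - a * (u n - k).
  by rewrite mulrBl mulrBr (ucomm a n ay); nc_ring.
apply: le_trans (cstar_normB cs _ _) _.
have := NM (u n - k) a; have := NM a (u n - k).
by have := N0 a; have := N0 (u n - k); have := N0 (u n.+1 - k); nra.
Qed.

(** Stands in for the order on self-adjoint elements. With [c = i b], commutation gives
    [star (a + c) * (a + c) = a^2 + b^2], and [2 a] is the sum of [a + c] and its adjoint. *)
Lemma cstar_norm_sqr_le a b : star a = a -> star b = b -> a * b = b * a ->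
  N a ^+ 2 <= N (a * a + b * b).
Proof.
move=> sa sb ab; pose c := 'i%C *: b.
have sc : star c = - c by rewrite (cstar_starZi cs) sb.
have cc : c * c = - (b * b).
  by rewrite /c -scalerAl -scalerAr scalerA -expr2 sqr_i scaleN1r.
have ac : a * c = c * a by rewrite /c -scalerAl -scalerAr ab.
have e : star (a + c) * (a + c) = a * a + b * b.
  rewrite starD sa sc.
  transitivity (a * a - c * c + (a * c - c * a)); first by nc_ring.
  by rewrite cc ac; nc_ring.
have Naa : N (a + a) = 2 * N a.
  by rewrite -[in RHS](cstar_half a) -scalerDr (cstar_normZr cs) ger0_norm ?invr_ge0 //; lra.
rewrite -e (cstar_normsq cs) lerXn2r ?nnegrE //.
have := ND (a + c) (star (a + c)); rewrite (cstar_norm_star cs) starD sa sc.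
have -> : a + c + (a - c) = a + a by nc_ring.
by rewrite Naa; lra.
Qed.

End CstarCalculus.

(** * Derivations near the norm of a self-adjoint element *)

Section CstarEdge.
Variables (R : realType) (B : algType R[i]) (N : B -> R) (star : B -> B).
Hypothesis cs : cstar_norm N star.
Implicit Types (x y : B) (r : R).

Let ND := cstar_normD cs.
Let NM := cstar_normM cs.
Let N0 := cstar_norm_ge0 cs.
Let starM := cstar_starM cs.

(* The resolvent [w = (1 + eta - x^2)^-1] has norm at least [1 / eta], because
   otherwise [1 + eta - x^2 - delta] would be a square for some [delta > eta], so
   that [x^2 <= 1 + eta - delta < 1]; the witness is [w] normalized. *)
Lemma cstar_norm_attained x g (eta : R) : 0 < eta -> star x = x -> N x = 1 ->
  star g = g -> g * x = x * g -> g * g = 1 - x * x ->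
  exists z, [/\ star z = z, N z = 1, g * z = z * g,
    N (g * z) ^+ 2 <= 2 * eta & 1 - 2 * eta <= N (z * x * z)].
Proof.
move=> eta0 sx Nx sg gx gg.
pose t : R := 1 + eta; have t0 : 0 < t by rewrite /t; lra.
pose q := t^-1%:C%C *: (x * x).
have Nq : N q = t^-1.
  by rewrite (cstar_normZr cs) (cstar_norm_sqr cs) // Nx expr1n mulr1 ger0_norm ?invr_ge0 // ltW.
have ti1 : t^-1 < 1 by rewrite invf_lt1 // /t; lra.
have [|W [W1 W2]] := @cstar_neumann _ _ _ _ cs q; first by rewrite Nq.
pose w := t^-1%:C%C *: W; pose T := t%:C%C *: (1 - q).
have TE : T = t%:C%C *: 1 - x * x.
  rewrite /T scalerBr /q scalerA -rmorphM divff ?gt_eqF //.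
  by rewrite rmorph1 scale1r.
have wT : w * T = 1.
  by rewrite /w /T -scalerAl -scalerAr scalerA -rmorphM mulVf ?gt_eqF // rmorph1 scale1r.
have Tw : T * w = 1.
  by rewrite /w /T -scalerAl -scalerAr scalerA -rmorphM divff ?gt_eqF // rmorph1 scale1r.
clearbody w; have sT : star T = T.
  by rewrite TE (cstar_starB cs) (cstar_starZr cs) (cstar_star1 cs) starM sx.
have sw : star w = w.
  have : star w * T = 1 by rewrite -{1}sT -starM Tw (cstar_star1 cs).
  by move=> h; rewrite -[star w]mulr1 -Tw mulrA h mul1r.
have commT a : a * (x * x) = x * x * a -> a * T = T * a.
  by move=> h; rewrite TE mulrBr mulrBl h -scalerAr -scalerAl mulr1 mul1r.
have commw a : a * (x * x) = x * x * a -> a * w = w * a.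
  by move=> h; apply: comm_inverse wT Tw _; exact: commT.
have xw : x * w = w * x by apply: commw; rewrite mulrA.
have gw : g * w = w * g.
  by apply: commw; rewrite mulrA gx -mulrA gx mulrA.
have w_neq0 : N w != 0.
  apply/eqP => /(cstar_norm_eq0 cs) w0.
  by have /eqP := wT; rewrite w0 mul0r eq_sym oner_eq0.
have Nw0 : 0 < N w by rewrite lt_neqAle eq_sym w_neq0 N0.
have Nw : eta^-1 <= N w.
  rewrite leNgt; apply/negP => lt.
  have lt' : eta < (N w)^-1 by rewrite -[eta]invrK ltf_pV2 ?posrE ?invr_gt0.
  (* [d <= 1 / N w] provides a square root [1 - s] of [1 - d w], and [d <= t] keeps [t - d]
     nonnegative. *)
  pose d := Num.min (N w)^-1 t.
  have [d1 d2] : d <= (N w)^-1 /\ d <= t by rewrite /d !ge_min !lexx orbT.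
  have d3 : eta < d by rewrite /d lt_min lt' /t; lra.
  have [||s [ss _ ss1 scomm]] := @cstar_sqrt _ _ _ _ cs (d%:C%C *: w).
  - by rewrite (cstar_starZr cs) sw.
  - rewrite (cstar_normZr cs) ger0_norm; last by lra.
    by rewrite -(mulVf w_neq0) ler_pM2r.
  have [||p [sp _ pp pcomm]] := @cstar_sqrt _ _ _ _ cs q.
  - by rewrite (cstar_starZr cs) starM sx.
  - by rewrite Nq ltW.
  have scomm' a : a * (x * x) = x * x * a -> a * s = s * a.
    by move=> h; apply: scomm; rewrite -scalerAl -scalerAr commw.
  have pcomm' a : a * (x * x) = x * x * a -> a * p = p * a.
    by move=> h; apply: pcomm; rewrite -scalerAl -scalerAr h.
  have xs : x * s = s * x by apply: scomm'; rewrite mulrA.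
  have xp : x * p = p * x by apply: pcomm'; rewrite mulrA.
  have ps : p * s = s * p.
    by apply: scomm'; rewrite mulrA -xp -mulrA -xp mulrA.
  pose b0 := (1 - p) * (1 - s).
  have sb0 : star b0 = b0.
    rewrite /b0 starM !(cstar_starB cs) (cstar_star1 cs) ss sp.
    transitivity (1 - p - s + s * p); [nc_ring | rewrite -ps; nc_ring].
  have bb0 : b0 * b0 = (1 - q) * (1 - d%:C%C *: w).
    rewrite -ss1 -pp /b0.
    transitivity ((1 - p) * ((1 - s) * (1 - p)) * (1 - s)); first by nc_ring.
    have -> : (1 - s) * (1 - p) = (1 - p) * (1 - s).
      transitivity (1 - p - s + s * p); [nc_ring | rewrite -ps; nc_ring].
    by nc_ring.
  (* [b^2 = T (1 - d w) = t - d - x^2], so [x^2 + b^2 = t - d < 1], which contradicts [N x = 1]. *)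
  pose b := (Num.sqrt t)%:C%C *: b0.
  have bb : b * b = (t - d)%:C%C *: 1 - x * x.
    rewrite /b -scalerAl -scalerAr scalerA -rmorphM -expr2 sqr_sqrtr ?ltW // bb0 scalerAl -/T.
    by rewrite mulrBr mulr1 -scalerAr Tw TE rmorphB scalerBl; nc_ring.
  have := @cstar_norm_sqr_le _ _ _ _ cs x b sx.
  rewrite Nx expr1n bb addrC subrK (cstar_normZr cs) (cstar_norm1 cs) mulr1 ger0_norm ?subr_ge0 //.
  have sb : star b = b by rewrite (cstar_starZr cs) sb0.
  have xb : x * b = b * x.
    rewrite /b -scalerAr -scalerAl; congr (_ *: _); rewrite /b0.
    transitivity ((x - x * p) * (1 - s)); first by nc_ring.
    rewrite xp; transitivity ((1 - p) * (x - x * s)); first by nc_ring.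
    by rewrite xs; nc_ring.
  by move=> /(_ sb xb); rewrite /t; lra.
(* Since [g^2 = T - eta] and [w T = 1]. The term [N w] in the resulting estimate is absorbed by
   [eta * N w ^+ 2], because [1 <= eta * N w]. *)
have gww : g * w * (w * g) = w - eta%:C%C *: (w * w).
  transitivity (w * (g * g) * w); first by rewrite -gw {1}gw; nc_ring.
  have -> : g * g = T - eta%:C%C *: 1.
    by rewrite gg TE rmorphD rmorph1 scalerDl scale1r; nc_ring.
  by rewrite mulrBr wT mulrBl mul1r mulr_algr [in RHS]scalerAl.
have eNw : 1 <= eta * N w by rewrite mulrC -ler_pdivrMr // div1r.
have Ngw : N (g * w) ^+ 2 <= 2 * eta * N w ^+ 2.
  rewrite -(cstar_normsq cs) starM sg sw -gw {2}gw gww.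
  apply: le_trans (cstar_normB cs _ _) _; rewrite (cstar_normZr cs) (cstar_norm_sqr cs) //.
  by rewrite gtr0_norm //; nra.
(* Multiplication by [x], of norm one, does not increase the norm, and it turns [w x w] into
   [w^2 - (g w) (w g)], whose second term is small. *)
have Nxw : (1 - 2 * eta) * N w ^+ 2 <= N (w * x * w).
  have : N (w * x * w) = N (w * x * w) * N x by rewrite Nx mulr1.
  have := NM (w * x * w) x; have -> : w * x * w * x = w * w - g * w * (w * g).
    transitivity (w * (1 - g * g) * w); last by rewrite -gw {1}gw; nc_ring.
    by rewrite gg -[LHS]mulrA -{2}xw; nc_ring.
  have := cstar_norm_star cs (g * w); rewrite starM sg sw => e.
  have := NM (g * w) (w * g); rewrite e.
  have := cstar_normB cs (w * w - g * w * (w * g)) (- (g * w * (w * g))).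
  rewrite (cstar_normN cs) opprK subrK (cstar_norm_sqr cs) //.
  by rewrite !expr2 in Ngw *; lra.
pose z := ((N w)^-1)%:C%C *: w.
have iw : 0 <= (N w)^-1 by rewrite invr_ge0 N0.
exists z; split.
- by rewrite (cstar_starZr cs) sw.
- by rewrite (cstar_normZr cs) ger0_norm // mulVf.
- by rewrite -scalerAl -scalerAr gw.
- rewrite -scalerAr (cstar_normZr cs) ger0_norm // exprMn exprVn mulrC ler_pdivrMr //.
  exact: exprn_gt0.
rewrite -!(scalerAl, scalerAr) scalerA -rmorphM (cstar_normZr cs) ger0_norm; last exact: mulr_ge0.
rewrite -expr2 exprVn [leRHS]mulrC ler_pdivlMr //.
exact: exprn_gt0.
Qed.

(* With [g = (1 - x^2)^(1/2)], the identity [D g g + g D g = - (D x x + x D x)] forces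
   [D x] to be small where [|x|] attains its norm. *)
Lemma cstar_derivation_far_from_one (D : B -> B) x :
  (forall a b, D (a + b) = D a + D b) ->
  (forall r a, D (r%:C%C *: a) = r%:C%C *: D a) ->
  (forall a b, D (a * b) = D a * b + a * D b) ->
  star x = x -> 1 <= N (D x - 1).
Proof.
move=> DD DZ DM sx; rewrite leNgt; apply/negP => lt.
have D0 : D 0 = 0 by have := DZ 0 0; rewrite rmorph0 !scale0r.
have D1 : D 1 = 0.
  have := DM 1 1; rewrite !mulr1 mul1r => /(congr1 (fun t => t - D 1)).
  by rewrite subrr addrK.
have Nx0 : N x != 0.
  apply/eqP => /(cstar_norm_eq0 cs) x0.
  by move: lt; rewrite x0 D0 sub0r (cstar_normN cs) (cstar_norm1 cs) ltxx.
have Nxgt : 0 < N x by rewrite lt_neqAle eq_sym Nx0 N0.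
(* After scaling to [N y = 1], [D y] equals [c] up to an error [e'] of norm less than [c]. *)
pose c := (N x)^-1; have c0 : 0 < c by rewrite invr_gt0.
pose y := c%:C%C *: x; pose e := D x - 1; pose e' := c%:C%C *: e.
have sy : star y = y by rewrite (cstar_starZr cs) sx.
have Ny : N y = 1 by rewrite (cstar_normZr cs) gtr0_norm // mulVf.
have Dy : D y = c%:C%C *: 1 + e'.
  by rewrite DZ /e' -scalerDr /e addrC subrK.
have Ne' : N e' < c by rewrite (cstar_normZr cs) gtr0_norm // -[ltRHS]mulr1 ltr_pM2l.
have [||k [sk _ kk kcomm]] := @cstar_sqrt _ _ _ _ cs (y * y).
- by rewrite starM sy.
- by rewrite (cstar_norm_sqr cs) // Ny expr1n.
pose g := 1 - k.
have sg : star g = g by rewrite /g (cstar_starB cs) (cstar_star1 cs) sk.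
have gy : g * y = y * g.
  by rewrite /g mulrBr mulrBl mul1r mulr1 kcomm // mulrA.
have DN a : D (- a) = - D a.
  by apply/eqP; rewrite -addr_eq0 -DD addNr D0.
have Dgg : D g * g + g * D g = - (D y * y + y * D y).
  by rewrite -!DM /g kk DD D1 add0r DN.
pose r := c - N e'; have r0 : 0 < r by rewrite /r; lra.
pose M := N (D g); have M0 : 0 <= M by exact: N0.
(* eta is chosen so that 2 c (1 - 2 eta) > 2 N e' + 2 M sqrt (2 eta) *)
pose rho := Num.min 1 (r / (2 * (M + c + 1))).
have rho0 : 0 < rho.
  by rewrite /rho lt_min ltr01 divr_gt0 // mulr_gt0 //; lra.
have rho1 : rho <= 1 by rewrite /rho ge_min lexx.
have rho2 : rho * (2 * (M + c + 1)) <= r.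
  rewrite -ler_pdivlMr; last by rewrite mulr_gt0 //; lra.
  by rewrite /rho ge_min lexx orbT.
pose eta := rho ^+ 2 / 2.
have eta0 : 0 < eta by rewrite divr_gt0 // exprn_gt0.
have [z [sz Nz gz Ngz Nzyz]] := cstar_norm_attained eta0 sy Ny sg gy kk.
have e2 : 2 * eta = rho ^+ 2 by rewrite /eta; field.
rewrite e2 in Ngz Nzyz.
have Ngz' : N (g * z) <= rho.
  by move: Ngz; rewrite ler_sqr // nnegrE // ltW.
(* Sandwich [Dgg] between two copies of [z]. The left side has norm at most [2 M rho], while the
   right side is [- 2 c z y z] up to [2 N e'], with [N (z y z)] close to one; this is impossible as
   [N e' < c]. *)
have : z * (D g * g + g * D g) * z = - (z * (D y * y + y * D y) * z).
  by rewrite Dgg mulrN mulNr.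
have -> : z * (D g * g + g * D g) * z = z * D g * (g * z) + g * z * D g * z.
  by rewrite {2}gz; nc_ring.
have -> : z * (D y * y + y * D y) * z =
    (c + c)%:C%C *: (z * y * z) + z * (e' * y + y * e') * z.
  rewrite Dy !mulrDl !mulrDr !mulrDl -!(scalerAl, scalerAr) !mulr1 !mul1r rmorphD scalerDl.
  by move: (c%:C%C *: (z * y * z)) => a; nc_ring.
set P := z * D g * _ + _; set Q := z * (e' * y + _) * z => PQ.
have NP : N P <= 2 * (M * rho).
  have h1 : N (z * D g * (g * z)) <= M * rho.
    apply: le_trans (NM _ _) _; apply: ler_pM => //.
    by apply: le_trans (NM _ _) _; rewrite Nz mul1r.
  have h2 : N (g * z * D g * z) <= rho * M.
    apply: le_trans (NM _ _) _; rewrite Nz mulr1.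
    by apply: le_trans (NM _ _) _; exact: ler_pM.
  by apply: le_trans (ND _ _) _; lra.
have NQ : N Q <= 2 * N e'.
  apply: le_trans (NM _ _) _; rewrite Nz mulr1; apply: le_trans (NM _ _) _.
  rewrite Nz mul1r; apply: le_trans (ND _ _) _.
  by have := NM e' y; have := NM y e'; rewrite Ny; lra.
have : N ((c + c)%:C%C *: (z * y * z)) <= N P + N Q.
  have -> : (c + c)%:C%C *: (z * y * z) = - (P + Q) by rewrite PQ; nc_ring.
  by rewrite (cstar_normN cs); exact: ND.
rewrite (cstar_normZr cs) gtr0_norm ?addr_gt0 //.
have : (c + c) * (1 - rho ^+ 2) <= (c + c) * N (z * y * z).
  by rewrite ler_pM2l ?addr_gt0.
have : rho ^+ 2 * c <= rho * c.
  by rewrite ler_pM2r // expr2 -[leRHS]mulr1 ler_pM2l.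
by rewrite /r in rho2; lra.
Qed.

End CstarEdge.

(** * The closed graph theorem *)

Section CstarClosedGraph.
Variables (R : realType) (B : algType R[i]) (N : B -> R) (star : B -> B).
Hypothesis cs : cstar_norm N star.
Implicit Types (x y : B) (r e : R).

Let N0 := cstar_norm_ge0 cs.

(** Baire's theorem for the cover by the sets where [f <= n]: one of them is dense in some ball.
    Otherwise nested balls, on which [f] exceeds [0, 1, 2, ...] in turn, would shrink to a point
    where [f] is infinite. *)
Lemma cstar_baire (f : B -> R) : exists n c r, 0 < r /\
  forall x, N (x - c) < r -> forall e, 0 < e -> exists2 x', N (x - x') < e & f x' <= n%:R.
Proof.
apply: contrapT => nh.
have step (p : nat * (B * R)) : exists q : B * R, 0 < p.2.2 ->
    [/\ 0 < q.2, q.2 <= p.2.2 / 4, N (q.1 - p.2.1) < p.2.2 / 4 &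
      forall x', N (q.1 - x') < q.2 -> p.1%:R < f x'].
  case: p => n [c r] /=; apply: contrapT => hq.
  have [r0|r0] := ltP 0 r; last by apply: hq; exists (c, r) => /lt_geF; rewrite r0.
  apply: nh; exists n, c, (r / 4); split; first by rewrite divr_gt0.
  move=> x hx e e0; apply: contrapT => hx'; apply: hq; exists (x, Num.min e (r / 4)) => _ /=.
  split => //; first by rewrite lt_min e0 divr_gt0.
    by rewrite ge_min lexx orbT.
  move=> x'; rewrite lt_min => /andP[xx' _]; rewrite ltNge; apply/negP => fx'.
  by apply: hx'; exists x'.
have [F hF] := choice step.
(* [s n] holds the centre and radius of the ball number [n]; the bound [n < f] holds on the ball
   number [n + 1]. *)
pose fix s n := if n is m.+1 then F (m, s m) else (0, 1).
have s_gt0 n : 0 < (s n).2.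
  elim: n => [|n ih] /=; first exact: ltr01.
  by have [] := hF (n, s n) ih.
have sP n : [/\ (s n.+1).2 <= (s n).2 / 4, N ((s n.+1).1 - (s n).1) < (s n).2 / 4 &
    forall x', N ((s n.+1).1 - x') < (s n.+1).2 -> n%:R < f x'].
  by have [] := hF (n, s n) (s_gt0 n).
(* As the radii shrink by a factor of at least 4, minus a third of the radius is a majorant for the
   centres, and the limit stays within a third of the radius of each centre. *)
have [||l [_ hl]] := @cstar_cvg_majorant _ _ _ _ cs (fun n => (s n).1) (fun n => - ((s n).2 / 3)) 0.
- by move=> n; have [h1 h2 _] := sP n; have := s_gt0 n; lra.
- by move=> n; have := s_gt0 n; lra.
have big n : n%:R < f l.
  by have [_ _] := sP n; apply; have := hl n.+1; have := s_gt0 n.+1; lra.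
have := big (Num.truncn (f l)).+1; rewrite ltNge => /negP; apply.
by apply: ltW; exact: truncnS_gt.
Qed.

(** The last hypothesis says that the separating space of [f] is zero, that is, that the graph is
    closed. By Baire and differences, a bound on [N (f x')] holds for a dense set of [x'] in a ball
    about [0]; after scaling, every [x] has arbitrarily close [x'] with [N (f x') <= K * N x].
    Approximating the successive remainders then bounds [f x]. *)
Lemma cstar_closed_graph (f : B -> B) :
  (forall a b, f (a + b) = f a + f b) ->
  (forall r a, f (r%:C%C *: a) = r%:C%C *: f a) ->
  (forall y, (forall e, 0 < e -> exists2 x, N x < e & N (f x - y) < e) -> y = 0) ->
  exists2 M, 0 <= M & forall x, N (f x) <= M * N x.
Proof.
move=> fD fZ fclos.
have f0 : f 0 = 0 by have := fZ 0 0; rewrite rmorph0 !scale0r.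
have fN a : f (- a) = - f a.
  by apply/eqP; rewrite -addr_eq0 -fD addNr f0.
have [n [c [r [r0 hc]]]] := cstar_baire (fun x => N (f x)).
have near0 x : N x < r -> forall e, 0 < e ->
    exists2 x', N (x - x') < e & N (f x') <= n%:R + n%:R.
  move=> xr e e0; have e20 : 0 < e / 2 by rewrite divr_gt0.
  have [||a ha fa] := hc (c + x) _ (e / 2); rewrite // 1?addrAC ?subrr ?add0r //.
  have [||b hb fb] := hc c _ (e / 2); rewrite // ?subrr ?(cstar_norm0 cs) //.
  exists (a - b).
    have -> : x - (a - b) = (c + x - a) - (c - b) by nc_ring.
    by have := cstar_normB cs (c + x - a) (c - b); lra.
  by rewrite fD fN; have := cstar_normB cs (f a) (f b); lra.
(* A nonzero [x] will be scaled to norm [r / 2], where the bound is [2 n]; hence the factor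
   [4 n / r]. *)
pose K := 4 * n%:R / r.
have K0 : 0 <= K by rewrite divr_ge0 // ?mulr_ge0 // ltW.
have approx (p : B * R) : exists x', 0 < p.2 -> N (p.1 - x') < p.2 /\ N (f x') <= K * N p.1.
  case: p => x e /=.
  have [e0|e0] := ltP 0 e; last by exists 0.
  have [->|x0] := eqVneq x 0.
    by exists 0 => _; rewrite f0 subr0 (cstar_norm0 cs) mulr0.
  have Nx : 0 < N x.
    rewrite lt_neqAle eq_sym N0 andbT; apply: contra x0 => /eqP /(cstar_norm_eq0 cs) ->.
    exact: eqxx.
  pose t := r / (2 * N x); have t0 : 0 < t by rewrite divr_gt0 // mulr_gt0.
  have [||x' h1 h2] := @near0 (t%:C%C *: x) _ (e * t).
  - rewrite (cstar_normZr cs) gtr0_norm // /t.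
    have -> : r / (2 * N x) * N x = r / 2 by field; rewrite gt_eqF.
    by lra.
  - exact: mulr_gt0.
  have ti0 : 0 < t^-1 by rewrite invr_gt0.
  exists (t^-1%:C%C *: x') => _; split.
    have -> : x - t^-1%:C%C *: x' = t^-1%:C%C *: (t%:C%C *: x - x').
      by rewrite scalerBr scalerA -rmorphM mulVf ?gt_eqF // rmorph1 scale1r.
    by rewrite (cstar_normZr cs) gtr0_norm // mulrC ltr_pdivrMr.
  rewrite fZ (cstar_normZr cs) gtr0_norm // mulrC ler_pdivrMr //.
  have -> : K * N x * t = n%:R + n%:R by rewrite /K /t; field; rewrite !gt_eqF.
  by [].
have [p hp] := choice approx.
exists (2 * K) => [|x]; first by rewrite mulr_ge0.
have [->|x0] := eqVneq x 0.
  by rewrite f0 (cstar_norm0 cs) mulr0.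
have Nx : 0 < N x.
  rewrite lt_neqAle eq_sym N0 andbT; apply: contra x0 => /eqP /(cstar_norm_eq0 cs) ->.
  exact: eqxx.
have pos k : 0 < N x * 2^-1 ^+ k by rewrite mulr_gt0 // exprn_gt0 ?invr_gt0.
(* [rm k] is what remains of [x] after [k] approximations, so [x - rm k] is the partial sum. *)
pose fix rm k := if k is m.+1 then rm m - p (rm m, N x * 2^-1 ^+ m.+1) else x.
have Nrm k : N (rm k) <= N x * 2^-1 ^+ k.
  case: k => [|k] /=; first by rewrite expr0 mulr1.
  by have [/ltW] := hp (rm k, N x * 2^-1 ^+ k.+1) (pos _).
have [||||l [_ hl]] := @cstar_cvg_geom _ _ _ _ cs (fun k => f (x - rm k)) (K * N x) 2^-1.
- by rewrite invr_ge0.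
- by lra.
- by rewrite mulr_ge0 // ltW.
- move=> k; rewrite -fN -fD.
  have -> : x - rm k.+1 - (x - rm k) = p (rm k, N x * 2^-1 ^+ k.+1).
    by rewrite /=; move: (p _) => q; nc_ring.
  have [_ /= h] := hp (rm k, N x * 2^-1 ^+ k.+1) (pos _).
  by apply: le_trans h _; rewrite -[leRHS]mulrA ler_wpM2l.
(* [rm k] tends to [0] while [f (rm k) = f x - f (x - rm k)] tends to [f x - l], so [f x - l] is in
   the separating space. *)
have -> : f x = l.
  apply/subr0_eq/fclos => e e0.
  have q0 : 0 <= (2^-1 : R) by rewrite invr_ge0.
  have q1 : (2^-1 : R) < 1 by lra.
  pose C := N x + K * N x / (1 - 2^-1).
  have C1 : 0 <= K * N x / (1 - 2^-1).
    by apply: divr_ge0; [exact: mulr_ge0 | lra].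
  have [k hk] := geom_small C q0 q1 e0; exists (rm k).
    apply: le_lt_trans (Nrm k) _; apply: le_lt_trans hk; rewrite ler_wpM2r ?exprn_ge0 //.
    by rewrite /C; lra.
  have -> : f (rm k) - (f x - l) = - (f (x - rm k) - l).
    by rewrite fD fN; nc_ring.
  rewrite (cstar_normN cs); apply: le_lt_trans (hl k) _; apply: le_lt_trans hk.
  by rewrite ler_wpM2r ?exprn_ge0 // /C; have := N0 x; lra.
have := hl 0%N; rewrite /= subrr f0 sub0r (cstar_normN cs) expr0 mulr1.
have -> : K * N x / (1 - 2^-1) = 2 * K * N x by field.
by [].
Qed.

End CstarClosedGraph.

(** * Traces and derivations *)

(** Closedness of the ideal is expressed by approximation in the real-valued norm [N]. *)
Definition cstar_simple (R : realType) (B : algType R[i]) (N : B -> R) : Prop :=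
  forall I : B -> Prop,
    I 0 -> (forall x y, I x -> I y -> I (x + y)) ->
    (forall a x, I x -> I (a * x) /\ I (x * a)) ->
    (forall y, (forall e : R, 0 < e -> exists2 x, I x & N (x - y) < e) -> I y) ->
    (forall x, I x -> x = 0) \/ (forall x, I x).

Record derivation (R : realType) (B : algType R[i]) (D : B -> B) : Prop := Derivation {
  derivationD : forall a b, D (a + b) = D a + D b;
  derivationZ : forall z a, D (z *: a) = z *: D a;
  derivationM : forall a b, D (a * b) = D a * b + a * D b }.

Record faithful_trace (R : realType) (B : algType R[i]) (star : B -> B)
    (tau : B -> R[i]) : Prop := FaithfulTrace {
  traceD : forall a b, tau (a + b) = tau a + tau b;
  traceZ : forall z a, tau (z *: a) = z * tau a;
  trace_ge0 : forall a, 0 <= tau (star a * a);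
  trace1 : tau 1 = 1;
  traceC : forall a b, tau (a * b) = tau (b * a);
  trace_faithful : forall x, tau (star x * x) = 0 -> x = 0 }.

Section DerivationBasics.
Variables (R : realType) (B : algType R[i]) (D : B -> B).
Hypothesis dD : derivation D.

Lemma derivation0 : D 0 = 0.
Proof. by rewrite -(scale0r (0 : B)) (derivationZ dD) !scale0r. Qed.

Lemma derivationN a : D (- a) = - D a.
Proof. by rewrite -scaleN1r (derivationZ dD) scaleN1r. Qed.

Lemma derivationB a b : D (a - b) = D a - D b.
Proof. by rewrite (derivationD dD) derivationN. Qed.

Lemma derivation1 : D 1 = 0.
Proof.
have := derivationM dD 1 1; rewrite !mulr1 mul1r => /(congr1 (fun t => t - D 1)).
by rewrite subrr addrK.
Qed.

End DerivationBasics.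

Section CstarTrace.
Variables (R : realType) (B : algType R[i]) (N : B -> R) (star : B -> B).
Hypothesis cs : cstar_norm N star.
Hypothesis simple : cstar_simple N.
Implicit Types (x y : B) (r e : R) (D : B -> B).

Let ND := cstar_normD cs.
Let NM := cstar_normM cs.
Let N0 := cstar_norm_ge0 cs.
Let starD := cstar_starD cs.
Let starM := cstar_starM cs.
Let starK := cstar_starK cs.

(* The separating space of [D] is a closed ideal; it is not the whole algebra since
   [1] stays at distance [>= 1] from the image of the self-adjoint elements. *)
Lemma star_derivation_bounded D : derivation D ->
  (forall a, D (star a) = star (D a)) ->
  exists2 M, 0 <= M & forall x, N (D x) <= M * N x.
Proof.
move=> dD Ds; have DD := derivationD dD; have DM := derivationM dD.
apply: (cstar_closed_graph cs) => // [r a|]; first exact: derivationZ.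
pose I y := forall e : R, 0 < e -> exists2 x, N x < e & N (D x - y) < e.
have D0 := derivation0 dD.
have IM a x : I x -> I (a * x) /\ I (x * a).
  (* This factor covers both terms of [D (a s) - a x = D a s + a (D s - x)], and their mirror
     images. *)
  move=> Ix; have c0 : 0 < N a + N (D a) + 1 by have := N0 a; have := N0 (D a); lra.
  split=> e e0.
    have [|s hs1 hs2] := Ix (e / (N a + N (D a) + 1)); first exact: divr_gt0.
    rewrite ltr_pdivlMr // in hs1; rewrite ltr_pdivlMr // in hs2.
    have := NM a s; have := N0 a; have := N0 (D a); have := N0 s; have := N0 (D s - x).
    exists (a * s); first by nra.
    have -> : D (a * s) - a * x = D a * s + a * (D s - x) by rewrite DM; nc_ring.
    apply: le_lt_trans (ND _ _) _; have := NM (D a) s; have := NM a (D s - x).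
    by nra.
  have [|s hs1 hs2] := Ix (e / (N a + N (D a) + 1)); first exact: divr_gt0.
  rewrite ltr_pdivlMr // in hs1; rewrite ltr_pdivlMr // in hs2.
  have := NM s a; have := N0 a; have := N0 (D a); have := N0 s; have := N0 (D s - x).
  exists (s * a); first by nra.
  have -> : D (s * a) - x * a = (D s - x) * a + s * D a by rewrite DM; nc_ring.
  apply: le_lt_trans (ND _ _) _; have := NM s (D a); have := NM (D s - x) a.
  by nra.
have [||||z|] // := simple (I := I).
- by move=> e e0; exists 0; rewrite ?D0 ?subrr (cstar_norm0 cs).
- move=> x y Ix Iy e e0; have e2 : 0 < e / 2 by rewrite divr_gt0.
  have [s s1 s2] := Ix _ e2; have [t t1 t2] := Iy _ e2.
  exists (s + t); first by have := ND s t; lra.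
  have -> : D (s + t) - (x + y) = (D s - x) + (D t - y) by rewrite DD; nc_ring.
  by have := ND (D s - x) (D t - y); lra.
- move=> y hy e e0; have e2 : 0 < e / 2 by rewrite divr_gt0.
  have [x Ix xy] := hy _ e2; have [s s1 s2] := Ix _ e2.
  exists s; first by lra.
  by have := cstar_dist_triangle cs x (D s) y; lra.
move=> /(_ 1); have h2 : 0 < (2^-1 : R) by rewrite invr_gt0.
move=> /(_ _ h2)[x _ hx].
(* Since [D] commutes with [star], the self-adjoint part [s] of [x] still satisfies
   [N (D s - 1) < 1/2]. *)
pose h : R[i] := ((2^-1 : R)%:C)%C; pose s := h *: (x + star x).
have ss : star s = s by rewrite /s (cstar_starZr cs) starD starK addrC.
have := cstar_derivation_far_from_one cs DD (fun r => derivationZ dD _) DM ss.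
have -> : D s - 1 = h *: ((D x - 1) + star (D x - 1)).
  rewrite /s (derivationZ dD) DD Ds (cstar_starB cs) (cstar_star1 cs).
  rewrite -[X in _ - X](cstar_half (1 : B)) -/h -scalerDr -scalerBr.
  by congr (_ *: _); nc_ring.
rewrite (cstar_normZr cs) gtr0_norm //.
have := ND (D x - 1) (star (D x - 1)); rewrite (cstar_norm_star cs); lra.
Qed.

Variable tau : B -> R[i].
Hypothesis tr : faithful_trace star tau.
Let tauD := traceD tr.
Let tauZ := traceZ tr.
Let tauC := traceC tr.

Lemma trace0 : tau 0 = 0.
Proof. by rewrite -(scale0r (0 : B)) tauZ mul0r. Qed.

Lemma traceN a : tau (- a) = - tau a.
Proof. by rewrite -scaleN1r tauZ mulN1r. Qed.

Lemma traceB a b : tau (a - b) = tau a - tau b.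
Proof. by rewrite tauD traceN. Qed.

(** If [y] is self-adjoint with [N y <= 1], then [1 - y] is the square of a self-adjoint element, so
    [tau y <= 1]. Apply this to [y] and [- y], then scale. *)
Lemma trace_norm_sa x : star x = x -> `|tau x| <= (N x)%:C%C.
Proof.
move=> sx; have le1 y : star y = y -> N y <= 1 -> tau y <= 1.
  move=> sy /(cstar_sqrt cs sy) [k [sk _ kk _]].
  rewrite -subr_ge0 -(trace1 tr) -traceB -kk.
  have {1}-> : 1 - k = star (1 - k) by rewrite (cstar_starB cs) (cstar_star1 cs) sk.
  exact: trace_ge0 tr _.
have bd y : star y = y -> N y <= 1 -> `|tau y| <= 1.
  move=> sy Ny; have h := le1 _ sy Ny.
  rewrite real_ler_norml ?ler1_real // h andbT lerNl -traceN.
  by apply: le1; [rewrite (cstar_starN cs) sy | rewrite (cstar_normN cs)].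
have [->|x0] := eqVneq x 0.
  by rewrite trace0 normr0 (cstar_norm0 cs).
have Nx : 0 < N x.
  rewrite lt_neqAle eq_sym N0 andbT; apply: contra x0 => /eqP /(cstar_norm_eq0 cs) ->.
  exact: eqxx.
pose y := (N x)^-1%:C%C *: x.
have -> : tau x = (N x)%:C%C * tau y.
  by rewrite -tauZ scalerA -rmorphM divff ?gt_eqF // rmorph1 scale1r.
rewrite normrM ger0_norm ?lecR ?N0 // -[leRHS]mulr1 ler_pM2l ?ltcR //; apply: bd.
  by rewrite (cstar_starZr cs) sx.
by rewrite (cstar_normZr cs) gtr0_norm ?invr_gt0 // mulVf ?gt_eqF.
Qed.

Lemma cstar_sa_decomp x : exists a b, [/\ star a = a, star b = b,
  x = a + 'i%C *: b, N a <= N x & N b <= N x].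
Proof.
pose h : R[i] := ((2^-1 : R)%:C)%C.
have Nh (c d : B) : N c <= N x -> N d <= N x -> N (h *: (c + d)) <= N x.
  move=> hc hd; rewrite (cstar_normZr cs) ger0_norm ?invr_ge0 //.
  by have := ND c d; lra.
exists (h *: (x + star x)), (h *: ('i%C *: (star x - x))); split.
- by rewrite (cstar_starZr cs) starD starK addrC.
- by rewrite (cstar_starZr cs) (cstar_starZi cs) (cstar_starB cs) starK -scalerN opprB.
- have -> : 'i%C *: (h *: ('i%C *: (star x - x))) = h *: (x - star x).
    rewrite scalerA mulrC -scalerA; congr (_ *: _).
    by rewrite scalerA -expr2 sqr_i scaleN1r opprB.
  rewrite -scalerDr addrACA subrr addr0 scalerDr; exact/esym/cstar_half.
- by apply: Nh; rewrite ?(cstar_norm_star cs).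
- rewrite scalerBr; apply: Nh; rewrite ?(cstar_normN cs) (cstar_normZi cs) //.
  by rewrite (cstar_norm_star cs).
Qed.

Lemma trace_norm x : `|tau x| <= (2 * N x)%:C%C.
Proof.
have [a [b [sa sb e Na Nb]]] := cstar_sa_decomp x.
rewrite e tauD tauZ; apply: le_trans (ler_normD _ _) _.
have i1 : `|'i%C| = 1 :> R[i] by rewrite normc_def /= expr0n add0r expr1n sqrtr1.
rewrite normrM i1 mul1r.
apply: le_trans (lerD (trace_norm_sa sa) (trace_norm_sa sb)) _.
by rewrite -rmorphD lecR -e; lra.
Qed.

Lemma trace_bounded_eq0 (z : R[i]) (M : R) : 0 <= M ->
  (forall t : R, 0 < t -> t <= 1 -> `|z| <= (M * t)%:C%C) -> z = 0.
Proof.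
move=> M0 h; have [m m0 zm] : exists2 m : R, 0 <= m & `|z| = m%:C%C.
  by rewrite normc_def; eexists; last reflexivity; exact: sqrtr_ge0.
apply/normr0_eq0; rewrite zm; congr (_%:C)%C.
apply/eqP; rewrite eq_le m0 andbT leNgt; apply/negP => mp.
have c0 : 0 < 2 * M + 2 by lra.
(* This [t] would give [m <= M t <= m / 2] with [m > 0]. *)
pose t := Num.min 1 (m / (2 * M + 2)).
have t0 : 0 < t by rewrite /t lt_min ltr01 divr_gt0.
have := h t t0; rewrite zm lecR /t ge_min lexx => /(_ isT); rewrite -/t => mt.
have : t <= m / (2 * M + 2) by rewrite /t ge_min lexx orbT.
rewrite ler_pdivlMr //; have := t0; nra.
Qed.

(* [u |-> tau (u^* D u)] is a homomorphism on unitaries, bounded because [D] is. *)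
Lemma trace_unitary_eq0 D M u : derivation D -> 0 <= M ->
  (forall x, N (D x) <= M * N x) ->
  star u * u = 1 -> u * star u = 1 -> tau (star u * D u) = 0.
Proof.
move=> dD M0 hM u1 u2.
have Nu : N u = 1.
  apply/eqP; rewrite -(@eqrXn2 _ 2) ?ler01 ?N0 // expr1n -(cstar_normsq cs) u1.
  by rewrite (cstar_norm1 cs).
have uX n : star (u ^+ n) * u ^+ n = 1.
  elim: n => [|n ih]; first by rewrite expr0 (cstar_star1 cs) mulr1.
  by rewrite exprS starM -mulrA [star u * _]mulrA u1 mul1r.
have cX n : tau (star (u ^+ n) * D (u ^+ n)) = n%:R * tau (star u * D u).
  elim: n => [|n ih]; first by rewrite expr0 (derivation1 dD) mulr0 trace0 mul0r.
  rewrite exprSr starM (derivationM dD) mulrDr tauD.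
  have -> : star u * star (u ^+ n) * (u ^+ n * D u) = star u * D u.
    by rewrite -mulrA [star (u ^+ n) * _]mulrA uX mul1r.
  have -> : tau (star u * star (u ^+ n) * (D (u ^+ n) * u)) =
      tau (star (u ^+ n) * D (u ^+ n)).
    by rewrite -mulrA tauC -!mulrA u2 mulr1.
  by rewrite ih -[n.+1]addn1 natrD mulrDl mul1r.
(* Powers of [u] have norm at most one, so [n * tau (star u * D u)] stays bounded as [n] grows. *)
have bd n : `|n%:R * tau (star u * D u)| <= (2 * M)%:C%C.
  rewrite -cX; apply: le_trans (trace_norm _) _; rewrite lecR ler_pM2l //.
  have Nun : N (u ^+ n) <= 1 by have := cstar_normX cs u n; rewrite Nu expr1n.
  apply: le_trans (NM _ _) _; rewrite (cstar_norm_star cs).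
  have := hM (u ^+ n); have := N0 (u ^+ n); have := N0 (D (u ^+ n)).
  by nra.
apply: (@trace_bounded_eq0 _ (2 * M * 2)) => [|t t0 t1]; first by lra.
pose n := Num.truncn t^-1.
have n1 : t^-1 < n.+1%:R by exact: truncnS_gt.
have := bd n.+1; rewrite normrM normr_nat => h.
have n0 : 0 < n.+1%:R :> R by [].
have h2 : `|tau (star u * D u)| <= (2 * M / n.+1%:R)%:C%C.
  rewrite rmorphM fmorphV rmorph_nat ler_pdivlMr ?ltr0n // mulrC.
  exact: h.
apply: le_trans h2 _; rewrite lecR ler_pdivrMr //.
have : 1 <= t * n.+1%:R by rewrite mulrC -ler_pdivrMr // div1r ltW.
by nra.
Qed.

(** For [y = t x] and [g = (1 - y^2)^(1/2) = 1 - k], the element [u = g + i y] is unitary. In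
    [tau (star u * D u) = 0] only [i tau (g D y - y D g)] survives; dividing by [i t] gives
    [tau (D x) = tau (k D x - x D k)], where [N k <= t^2]. *)
Lemma trace_bounded_derivation_sa D M x : derivation D -> 0 <= M ->
  (forall x, N (D x) <= M * N x) -> star x = x -> N x <= 1 -> tau (D x) = 0.
Proof.
move=> dD M0 hM sx Nx.
have DD := derivationD dD; have DM := derivationM dD.
apply: (@trace_bounded_eq0 _ (4 * M)) => [|t t0 t1]; first by lra.
pose y := t%:C%C *: x.
have sy : star y = y by rewrite (cstar_starZr cs) sx.
have Ny : N y <= t by rewrite (cstar_normZr cs) gtr0_norm // -[leRHS]mulr1 ler_pM2l.
have yE : y = t%:C%C *: x by []; clearbody y.
have Nyy : N (y * y) <= t * t.
  by apply: le_trans (NM _ _) _; apply: ler_pM.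
have [||k [sk Nk kk kcomm]] := @cstar_sqrt _ _ _ _ cs (y * y).
- by rewrite starM sy.
- by apply: le_trans Nyy _; nra.
pose g := 1 - k.
have sg : star g = g by rewrite /g (cstar_starB cs) (cstar_star1 cs) sk.
have gy : g * y = y * g.
  by rewrite /g mulrBr mulrBl mul1r mulr1 kcomm // mulrA.
pose c := 'i%C *: y; pose u := g + c.
have sc : star c = - c by rewrite (cstar_starZi cs) sy.
have cc : c * c = - (y * y).
  by rewrite /c -scalerAl -scalerAr scalerA -expr2 sqr_i scaleN1r.
have gc : g * c = c * g by rewrite /c -scalerAl -scalerAr gy.
have su : star u = g - c by rewrite /u starD sg sc.
have u1 : star u * u = 1.
  rewrite su /u; transitivity (g * g - c * c + (g * c - c * g)); first by nc_ring.
  by rewrite gc cc kk; nc_ring.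
have u2 : u * star u = 1.
  rewrite su /u; transitivity (g * g - c * c - (g * c - c * g)); first by nc_ring.
  by rewrite gc cc kk; nc_ring.
have := trace_unitary_eq0 dD M0 hM u1 u2.
have Dc : D c = 'i%C *: D y by rewrite (derivationZ dD).
have -> : star u * D u = (g * D g + y * D y) + 'i%C *: (g * D y - y * D g).
  rewrite su /u DD.
  transitivity (g * D g - c * D c + (g * D c - c * D g)); first by nc_ring.
  by rewrite Dc /c -!scalerAl -!scalerAr scalerA -expr2 sqr_i scaleN1r opprK scalerBr.
(* By cyclicity of the trace, twice this value is [tau (D (g^2 + y^2)) = tau (D 1)]. *)
have gDg : tau (g * D g + y * D y) = 0.
  have e : D (g * g + y * y) = 0 by rewrite kk subrK (derivation1 dD).
  have : tau (D (g * g + y * y)) = 0 by rewrite e trace0.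
  rewrite DD !DM !tauD (tauC (D g)) (tauC (D y)) => h.
  apply: (@mulfI _ 2); first by rewrite pnatr_eq0.
  by rewrite mulr0 -h; ring.
rewrite tauD gDg add0r tauZ => /eqP; rewrite mulf_eq0 => /orP[/eqP/(congr1 (@complex.Im R))/eqP|].
  by rewrite /= oner_eq0.
rewrite yE (derivationZ dD) -scalerAr -scalerAl -scalerBr tauZ mulf_eq0.
have -> /= : (t%:C%C == 0) = false by apply/eqP => /(@complexI R) t00; rewrite t00 ltxx in t0.
rewrite /g (derivationB dD) (derivation1 dD) sub0r => /eqP h.
have -> : tau (D x) = tau (k * D x - x * D k).
  apply/eqP; rewrite -subr_eq0 -traceB -h; apply/eqP; congr (tau _).
  by nc_ring.
apply: le_trans (trace_norm _) _; rewrite lecR.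
have := cstar_normB cs (k * D x) (x * D k); have := NM k (D x); have := NM x (D k).
have NDx : N (D x) <= M by have := hM x; nra.
have NDk : N (D k) <= M * (t * t).
  apply: le_trans (hM k) _; apply: ler_wpM2l => //; exact: le_trans Nk Nyy.
have kt : N k <= t * t by exact: le_trans Nk Nyy.
have p1 : N k * N (D x) <= t * t * M by apply: ler_pM.
have p2 : N x * N (D k) <= 1 * (M * (t * t)) by apply: ler_pM.
have p3 : M * (t * t) <= M * t by apply: ler_wpM2l => //; rewrite -[leRHS]mulr1 ler_pM2l.
by lra.
Qed.

Lemma trace_bounded_derivation D M x : derivation D -> 0 <= M ->
  (forall x, N (D x) <= M * N x) -> tau (D x) = 0.
Proof.
move=> dD M0 hM; have sa y : star y = y -> tau (D y) = 0.
  move=> sy; have c0 : 0 < N y + 1 by have := N0 y; lra.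
  pose z := (N y + 1)^-1%:C%C *: y.
  have -> : y = (N y + 1)%:C%C *: z.
    by rewrite /z scalerA -rmorphM divff ?gt_eqF // rmorph1 scale1r.
  rewrite (derivationZ dD) tauZ (@trace_bounded_derivation_sa D M) ?mulr0 //.
    by rewrite /z (cstar_starZr cs) sy.
  rewrite /z (cstar_normZr cs) gtr0_norm ?invr_gt0 // mulrC ler_pdivrMr //; lra.
have [a [b [ha hb -> _ _]]] := cstar_sa_decomp x.
by rewrite (derivationD dD) (derivationZ dD) tauD tauZ !sa // mulr0 addr0.
Qed.

(** [Ds a = star (D (star a))] is again a derivation, and both [D + Ds] and [i (D - Ds)] commute
    with [star], hence are bounded and killed by [tau]; [D] is a combination of the two. *)
Theorem trace_derivation_eq0 D x : derivation D -> tau (D x) = 0.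
Proof.
move=> dD; have DD := derivationD dD; have DM := derivationM dD.
have DZ := derivationZ dD.
have star_der D' : derivation D' -> (forall a, D' (star a) = star (D' a)) ->
    tau (D' x) = 0.
  move=> dD' h; have [M M0 hM] := star_derivation_bounded dD' h.
  exact: trace_bounded_derivation dD' M0 hM.
pose Ds a := star (D (star a)).
have dDs : derivation Ds.
  split=> [a b|z a|a b]; rewrite /Ds.
  - by rewrite starD DD starD.
  - by rewrite !(cstar_starZ cs) DZ (cstar_starZ cs) conjcK.
  - by rewrite starM DM starD !starM !starK addrC.
have ZZ (E F : B -> B) (z w : R[i]) : derivation E -> derivation F ->
    derivation (fun a => z *: E a + w *: F a).
  move=> dE dF; split=> [a b|v a|a b].
  - by rewrite (derivationD dE) (derivationD dF) !scalerDr addrACA.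
  - by rewrite (derivationZ dE) (derivationZ dF) scalerDr !scalerA ![_ * v]mulrC.
  - rewrite (derivationM dE) (derivationM dF) !scalerDr mulrDl mulrDr.
    by rewrite -!scalerAl -!scalerAr addrACA.
have e1 : tau (1 *: D x + 1 *: Ds x) = 0.
  apply: (star_der _ (ZZ _ _ _ _ dD dDs)) => a.
  by rewrite !scale1r starD /Ds !starK addrC.
have e2 : tau ('i%C *: D x + (- 'i%C) *: Ds x) = 0.
  apply: (star_der _ (ZZ _ _ _ _ dD dDs)) => a.
  rewrite !scaleNr starD (cstar_starN cs) !(cstar_starZi cs) /Ds !starK.
  by rewrite opprK addrC.
move: e1 e2; rewrite !scale1r !tauD !tauZ => e1 e2.
have i0 : 'i%C != 0 :> R[i].
  by apply/eqP => /(congr1 (@complex.Im R))/eqP; rewrite /= oner_eq0.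
have e3 : tau (D x) - tau (Ds x) = 0.
  by apply: (mulfI i0); rewrite mulr0 -e2; ring.
apply: (@mulfI _ 2); first by rewrite pnatr_eq0.
by rewrite mulr0 -[RHS]addr0 -{1}e1 -{1}e3; ring.
Qed.

End CstarTrace.

(** * The map phi *)

Section WeakTwoLocal.
Variables (R : realType) (B : algType R[i]) (N : B -> R) (star : B -> B).
Hypothesis cs : cstar_norm N star.
Hypothesis simple : cstar_simple N.
Variable tau : B -> R[i].
Hypothesis tr : faithful_trace star tau.
Variable phi : B -> B.
Hypothesis phiP : forall a b, exists2 D, derivation D &
  phi a * b + a * phi b = D (a * b).

(** [- phi] is an adjoint of [phi] for the bilinear form [tau (a b)]. As this form is nondegenerate,
    [phi] must be linear. *)
Lemma phi_adjoint a b : tau (phi a * b) = - tau (a * phi b).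
Proof.
have [D dD h] := phiP a b; apply/eqP; rewrite -addr_eq0 -(traceD tr) h.
by rewrite (trace_derivation_eq0 cs simple tr).
Qed.

Lemma trace_separating w : (forall c, tau (w * c) = 0) -> w = 0.
Proof. by move=> h; apply: (trace_faithful tr); rewrite (traceC tr). Qed.

Lemma phi_additive a b : phi (a + b) = phi a + phi b.
Proof.
apply/subr0_eq/trace_separating => c.
rewrite mulrBl mulrDl (traceB tr) (traceD tr) !phi_adjoint mulrDl (traceD tr).
by rewrite opprD subrr.
Qed.

Lemma phi_scale z a : phi (z *: a) = z *: phi a.
Proof.
apply/subr0_eq/trace_separating => c.
rewrite mulrBl (traceB tr) -scalerAl (traceZ tr) !phi_adjoint -scalerAl (traceZ tr).
by rewrite mulrN subrr.
Qed.

Lemma phi1 : phi 1 = 0.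
Proof.
have [D dD] := phiP 1 1; rewrite !mulr1 mul1r (derivation1 dD).
exact: cstar_torsion2.
Qed.

Lemma phiN a : phi (- a) = - phi a.
Proof. by rewrite -scaleN1r phi_scale scaleN1r. Qed.

(** As [w p = 1] and [D 1 = 0], the hypothesis on [phi] reads [phi w * p + w * phi p = 0]. *)
Lemma phi_inverse p w : w * p = 1 -> p * w = 1 -> phi w = - (w * phi p * w).
Proof.
move=> wp pw; have [D dD] := phiP w p; rewrite wp (derivation1 dD) => h.
rewrite -[LHS]mulr1 -pw mulrA; apply/eqP; rewrite -addr_eq0 -mulrDl h.
by rewrite mul0r.
Qed.

(* Hua's trick: apply [phi_inverse] to the three inverses in
   [(1 - x)^-1 + (1 + x)^-1 = 2 (1 - x^2)^-1]. *)
Lemma phi_sqr_small x : N x < 1 -> phi (x * x) = phi x * x + x * phi x.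
Proof.
move=> Nx; have [P [P1 P2]] := cstar_neumann cs Nx.
have [|Q [Q1 Q2]] := cstar_neumann cs (q := - x); first by rewrite (cstar_normN cs).
rewrite opprK in Q1 Q2; pose p := 1 - x; pose q := 1 + x.
rewrite -/p -/q in P1 P2 Q1 Q2.
have pq : p * q = q * p by rewrite /p /q; nc_ring.
have PQi : P * Q * (q * p) = 1 by rewrite mulrA -[P * Q * q]mulrA Q1 mulr1.
have iPQ : q * p * (P * Q) = 1 by rewrite mulrA -[q * p * P]mulrA P2 mulr1.
have sum : P + Q = P * Q + P * Q.
  transitivity (P * (q + p) * Q); last by rewrite /p /q; nc_ring.
  by rewrite mulrDr mulrDl -mulrA Q2 P1 mulr1 mul1r.
have phip : phi p = - phi x by rewrite /p phi_additive phi1 phiN add0r.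
have phiq : phi q = phi x by rewrite /q phi_additive phi1 add0r.
have e := congr1 phi sum; move: e; rewrite !phi_additive.
rewrite (phi_inverse P1 P2) (phi_inverse Q1 Q2) (phi_inverse PQi iPQ) phip phiq => e.
(* Multiplying by [q p] and [p q] clears the inverses and leaves
   [q phi(x) q - p phi(x) p = 2 phi(x^2)]; the left side expands to [2 (phi(x) x + x phi(x))]. *)
have e2 := congr1 (fun t => q * p * t * (p * q)) e.
have qpP : q * p * P = q by rewrite -mulrA P2 mulr1.
have Ppq : P * (p * q) = q by rewrite mulrA P1 mul1r.
have qpQ : q * p * Q = p by rewrite -pq -mulrA Q2 mulr1.
have Qpq : Q * (p * q) = p by rewrite pq mulrA Q1 mul1r.
have PQpq : P * Q * (p * q) = 1 by rewrite pq.
have phix2 : phi (q * p) = - phi (x * x).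
  have -> : q * p = 1 - x * x by rewrite /p /q; nc_ring.
  by rewrite phi_additive phi1 phiN add0r.
have l : q * p * (- (P * - phi x * P) - Q * phi x * Q) * (p * q) =
   q * phi x * q - p * phi x * p.
  transitivity (q * p * P * phi x * (P * (p * q)) - q * p * Q * phi x * (Q * (p * q))).
    by nc_ring.
  by rewrite qpP Ppq qpQ Qpq.
have r : q * p * (- (P * Q * phi (q * p) * (P * Q)) - P * Q * phi (q * p) * (P * Q)) * (p * q) =
   phi (x * x) + phi (x * x).
  transitivity (- (q * p * (P * Q) * phi (q * p) * (P * Q * (p * q)))
    - q * p * (P * Q) * phi (q * p) * (P * Q * (p * q))); first by nc_ring.
  by rewrite iPQ PQpq mul1r mulr1 phix2 opprK.
rewrite l r in e2; apply/subr0_eq/(@cstar_torsion2 R).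
transitivity ((phi (x * x) + phi (x * x)) - (phi x * x + x * phi x) - (phi x * x + x * phi x)).
  by nc_ring.
by rewrite -e2 /p /q; nc_ring.
Qed.

Lemma phi_sqr x : phi (x * x) = phi x * x + x * phi x.
Proof.
have c0 : 0 < N x + 1 by have := cstar_norm_ge0 cs x; lra.
pose y := (N x + 1)^-1%:C%C *: x.
have -> : x = (N x + 1)%:C%C *: y.
  by rewrite /y scalerA -rmorphM divff ?gt_eqF // rmorph1 scale1r.
have Ny : N y < 1.
  rewrite /y (cstar_normZr cs) gtr0_norm ?invr_gt0 // mulrC ltr_pdivrMr //; lra.
clearbody y.
rewrite phi_scale -!scalerAl -!scalerAr !phi_scale phi_sqr_small //.
by rewrite !scalerDr.
Qed.

(** The elements [q] with [P x q = 0] for all [x] form a closed ideal containing every commutator.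
    If it is everything, then [P = 0]. If it is zero, the algebra is commutative, so the
    skew-symmetric defect is also symmetric and vanishes. *)
Theorem weak_two_local_derivation : derivation phi.
Proof.
split; [exact: phi_additive | exact: phi_scale |] => a b.
pose P := leibniz_defect phi a b.
suff : P = 0 by rewrite /P /leibniz_defect -addrA -opprD => /subr0_eq.
have Pcd c d x : P * x * (c * d - d * c) = 0.
  apply: leibniz_defect_mul_comm => //; first exact: cstar_torsion2.
  - exact: phi_additive.
  - exact: phi_sqr.
  - exact: cstar_semiprime cs.
have [|||y hy|comm|all] := simple (I := fun q => forall x, P * x * q = 0).
- by move=> x; rewrite mulr0.
- by move=> q r hq hr x; rewrite mulrDr hq hr addr0.
- move=> c q hq; split=> x; last by rewrite mulrA hq mul0r.
  by have := hq (x * c); rewrite !mulrA.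
- move=> x; apply: (cstar_norm_le0 cs) => e e0.
  have c0 : 0 < N (P * x) + 1 by have := cstar_norm_ge0 cs (P * x); lra.
  have [|q hq qy] := hy (e / (N (P * x) + 1)); first exact: divr_gt0.
  have -> : P * x * y = - (P * x * (q - y)) by rewrite mulrBr hq; nc_ring.
  rewrite (cstar_normN cs); apply: le_trans (cstar_normM cs _ _) _.
  move: qy; rewrite ltr_pdivlMr //; have := cstar_norm_ge0 cs (q - y).
  by have := cstar_norm_ge0 cs (P * x); nra.
- have cm (c d : B) : c * d = d * c.
    by apply/subr0_eq/comm => x; exact: Pcd.
  apply: (@cstar_torsion2 R).
  have {2}-> : P = leibniz_defect phi b a.
    by rewrite /P /leibniz_defect (cm b a) (cm (phi b) a) (cm b (phi a)); nc_ring.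
  by rewrite (leibniz_defectC phi_additive phi_sqr) subrr.
by have := all 1 1; rewrite !mulr1.
Qed.

End WeakTwoLocal.

(** * From a normed space with a product to an algebra *)

Section CstarCarrier.
Variables (R : realType) (A : completeNormedModType R[i]).
Variables (mul : A -> A -> A) (one : A) (star : A -> A).
Hypothesis HA : unital_Cstar_algebra mul one star.

Let mulA : associative mul.
Proof. by case: HA => -[]. Qed.
Let mul1l : left_id one mul.
Proof. by case: HA => -[_ m1 _ _ _] _ a; case: (m1 a). Qed.
Let mul1r : right_id one mul.
Proof. by case: HA => -[_ m1 _ _ _] _ a; case: (m1 a). Qed.
Let mulDl : left_distributive mul +%R.
Proof. by case: HA => -[_ _ mD _ _] _ a b c; case: (mD a b c). Qed.
Let mulDr : right_distributive mul +%R.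
Proof. by case: HA => -[_ _ mD _ _] _ a b c; case: (mD a b c). Qed.
Let one_neq0 : one != 0.
Proof. by case: HA => -[_ _ _ _ []]. Qed.
Let scaleAl (z : R[i]) (a b : A) : z *: mul a b = mul (z *: a) b.
Proof. by case: HA => -[_ _ _ mZ _] _; case: (mZ z a b). Qed.
Let scaleAr (z : R[i]) (a b : A) : z *: mul a b = mul a (z *: b).
Proof. by case: HA => -[_ _ _ mZ _] _; case: (mZ z a b). Qed.

(** An alias of [A] indexed by the axioms, so that the algebra structure built from them can be
    inferred from the type. *)
Definition cstar_carrier (_ : unital_Cstar_algebra mul one star) : Type := A.
Local Notation B := (cstar_carrier HA).

HB.instance Definition _ := GRing.Lmodule.on B.
HB.instance Definition _ :=
  GRing.Zmodule_isNzRing.Build B mulA mul1l mul1r mulDl mulDr one_neq0.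
HB.instance Definition _ := GRing.Lmodule_isLalgebra.Build R[i] B scaleAl.
HB.instance Definition _ := GRing.Lalgebra_isAlgebra.Build R[i] B scaleAr.

Definition real_norm (a : A) : R := complex.Re `|a|.

Lemma real_normE (a : A) : `|a| = ((real_norm a)%:C)%C.
Proof.
rewrite /real_norm; have := @ger0_Im R _ (normr_ge0 a).
by case: `|a| => x y /= ->.
Qed.

Lemma lt_real_norm (a : A) (e : R[i]) : 0 < e ->
  (`|a| < e) = (real_norm a < complex.Re e).
Proof.
move=> e0; have := @ger0_Im R _ (ltW e0); rewrite real_normE.
by case: e {e0} => x y /= ->; rewrite -ltcR.
Qed.

Lemma gt0_Re (e : R[i]) : 0 < e -> 0 < complex.Re e.
Proof. by case: e => x y; rewrite ltcE /= => /andP[]. Qed.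

Lemma real_norm_complete (u : nat -> A) :
  (forall e : R, 0 < e -> exists n0, forall m n, (n0 <= m)%N -> (n0 <= n)%N ->
     real_norm (u m - u n) < e) ->
  exists l, forall e : R, 0 < e -> exists n0, forall n, (n0 <= n)%N ->
     real_norm (u n - l) < e.
Proof.
move=> hu; have : cvg (u @ \oo)%classic.
  apply: cauchy_cvg; apply: cauchy_exP => e e0.
  have [n0 hn0] := hu _ (gt0_Re e0); exists (u n0); exists n0 => // n /= n0n.
  by rewrite /= -ball_normE /= lt_real_norm // hn0.
move=> /cvg_ex[l ul]; exists l => e e0.
have ec : 0 < (e%:C)%C by rewrite ltcR.
move/cvgrPdist_lt: ul => /(_ _ ec)[n0 _ hn0]; exists n0 => n n0n.
have := hn0 n n0n; rewrite distrC lt_real_norm //.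
Qed.

Lemma cstar_carrier_norm :
  @cstar_norm R (cstar_carrier HA : algType R[i]) real_norm star.
Proof.
have := HA; move=> [[_ _ _ _ [nM _]] [sD sZ sM sK nsq]].
split.
- by move=> a b; rewrite -lecR rmorphD /= -!real_normE; exact: ler_normD.
- by move=> a a0; apply/normr0_eq0; rewrite real_normE a0.
- by move=> z a; rewrite -!real_normE; exact: normrZ.
- by move=> a b; rewrite -lecR rmorphM /= -!real_normE; exact: nM.
- exact: real_norm_complete.
- exact: sD.
- exact: sZ.
- exact: sM.
- exact: sK.
- by move=> a; apply: (@complexI R); rewrite rmorphXn /= -!real_normE; exact: nsq.
Qed.

Lemma cstar_carrier_simple : simple_algebra mul ->
  @cstar_simple R (cstar_carrier HA : algType R[i]) real_norm.
Proof.
move=> simp I I0 ID IM Icl.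
have [] := simp (I : set A).
- split => //.
  (* Closure under scalars comes from [z x = (z 1) x]. *)
  + by move=> z x Ix; have [h _] := IM (z *: 1) x Ix; rewrite mulr_algl in h.
  + move=> y hy; apply: Icl => e e0.
    have ec : 0 < (e%:C)%C by rewrite ltcR.
    have [x [Ix]] := hy _ (nbhsx_ballx y _ ec).
    by rewrite -ball_normE /= distrC lt_real_norm // => h; exists x.
- by move=> e; left => x Ix; have : (I : set A) x by []; rewrite e.
by move=> e; right => x; have : (setT : set A) x by []; rewrite -e.
Qed.

End CstarCarrier.

Unset Implicit Arguments.

Theorem theorem3p2 (R : realType) (A : completeNormedModType R[i])
    (mul : A -> A -> A) (one : A) (star : A -> A)
    (HA : unital_Cstar_algebra mul one star)
    (Hsimple : simple_algebra mul)
    (Htrace : exists tau : A -> R[i], faithful_tracial_state mul one star tau)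
    (phi : A -> A)
    (Hphi : forall a b : A, exists D : A -> A,
        linear_derivation mul D /\ mul (phi a) b + mul a (phi b) = D (mul a b)) :
  linear_derivation mul phi.
Proof.
case: Htrace => tau [tD tZ [tp t1] tC tf].
have tr : @faithful_trace R (cstar_carrier HA : algType R[i]) star tau by split.
have dP (a b : cstar_carrier HA) : exists2 D, @derivation R (cstar_carrier HA) D &
    (phi a : cstar_carrier HA) * b + a * (phi b : cstar_carrier HA) = D (a * b).
  have [D [[[DD DZ] DM] h]] := Hphi a b.
  by exists D.
have [pD pZ pM] := weak_two_local_derivation (cstar_carrier_norm HA)
  (cstar_carrier_simple Hsimple) tr dP.
by split; [split | ].
Qed.
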